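(* Let $w\in F$ be positive, and suppose we are given rational numbers $p/q$ and $c/d$ (with $c/d$ reduced) so that $c/d$ is a value of the function $R(w,p/q,\cdot)$ (so necessarily $d\le q$). Then $$\inf\{t : R(w,p/q,t)=c/d\}$$ is rational, and there is an algorithm to compute it. Moreover, if $u/v$ is this infimal value, then $R(w,p/q,u/v)=c/d$.
   Context: $F$ is the free group on two generators $a,b$. A word in $F$ is positive if it contains only the letters $a$ and $b$, and no $a^{-1}$ or $b^{-1}$. $\mathrm{Homeo}^+(S^1)^\sim$ denotes the group of increasing homeomorphisms of $\mathbb{R}$ commuting with $x\mapsto x+1$ (lifts of orientation-preserving homeomorphisms of $S^1=\mathbb{R}/\mathbb{Z}$), and $\mathrm{rot}^\sim(\varphi)=\lim_{n\to\infty}(\varphi^n(x)-x)/n\in\mathbb{R}$ is the real-valued Poincaré rotation number. For $w\in F$ and $r,s\in\mathbb{R}$, $R(w,r,s)$ denotes the supremum of $\mathrm{rot}^\sim(\rho(w))$ over all homomorphisms $\rho:F\to \mathrm{Homeo}^+(S^1)^\sim$ with $\mathrm{rot}^\sim(\rho(a))=r$ and $\mathrm{rot}^\sim(\rho(b))=s$.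
   Formalization: The letter b is required to occur in w, since for w = aⁿ the set is all of ℝ and its infimum is −∞; the parenthetical d ≤ q is asserted only when a occurs in w, since it fails for w = b, as R(b,0,1/2) = 1/2. *)

(* Defs.v *)
From HB Require Import structures.
From mathcomp Require Import all_boot all_order all_algebra.
From mathcomp Require Import all_classical all_reals all_analysis.

Set Implicit Arguments.
Unset Strict Implicit.
Unset Printing Implicit Defensive.

Import Order.TTheory GRing.Theory Num.Theory numFieldNormedType.Exports.

Local Open Scope classical_set_scope.

(* A letter (x, e) stands for x if e = false, and for x^-1 if e = true. *)
Section FreeGroup.
Variable X : choiceType.

Local Notation letter := (X * bool)%type.

Implicit Types (l : letter) (u v w : seq letter).

Definition linv l : letter := (l.1, ~~ l.2).

Definition reduced w := sorted (fun l l' => l' != linv l) w.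

Definition lcons l w :=
  if w is l' :: w' then if l' == linv l then w' else l :: w else [:: l].

Definition reduce w := foldr lcons [::] w.

Lemma linvK : involutive linv.
Proof. by case=> x e; rewrite /linv /= negbK. Qed.

Lemma lcons_reduced l w : reduced w -> reduced (lcons l w).
Proof.
case: w => [|l' w] //= pw; case: eqP => [_|/eqP ne] /=.
  exact: path_sorted pw.
by rewrite ne.
Qed.

Lemma foldr_reduced u w : reduced w -> reduced (foldr lcons w u).
Proof. by move=> rw; elim: u => //= l u; apply: lcons_reduced. Qed.

Lemma reduce_reduced w : reduced (reduce w).
Proof. exact: foldr_reduced. Qed.

Lemma reduce_id w : reduced w -> reduce w = w.
Proof.
elim: w => // l w IH rw; rewrite [LHS]/(lcons l (reduce w)) IH.
  by case: w rw {IH} => //= l' w /andP[/negPf -> _].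
exact: path_sorted rw.
Qed.

Lemma lconsK l w : reduced w -> lcons l (lcons (linv l) w) = w.
Proof.
case: w => [|l' w] /=; first by rewrite eqxx.
rewrite linvK; case: eqP => [-> | _ _] /=; last by rewrite eqxx.
by case: w => [|l'' w] //= /andP[/negPf ->].
Qed.

Lemma foldr_lcons l u w : reduced w ->
  foldr lcons w (lcons l u) = lcons l (foldr lcons w u).
Proof.
move=> rw; case: u => [|l' u] //=; case: eqP => [->|] //=.
by rewrite lconsK //; apply: foldr_reduced.
Qed.

Lemma foldr_reduce u w : reduced w ->
  foldr lcons w (reduce u) = foldr lcons w u.
Proof. by move=> rw; elim: u => //= l u IH; rewrite foldr_lcons // IH. Qed.

Lemma reduce_catl u v : reduce (reduce u ++ v) = reduce (u ++ v).
Proof.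
by rewrite /reduce !foldr_cat foldr_reduce //; exact: reduce_reduced.
Qed.

Lemma reduce_catr u v : reduce (u ++ reduce v) = reduce (u ++ v).
Proof.
rewrite /reduce !foldr_cat -/(reduce v) -/(reduce (reduce v)).
by rewrite (reduce_id (reduce_reduced v)).
Qed.

Definition winv w := rev (map linv w).

Lemma winv_reduced w : reduced w -> reduced (winv w).
Proof.
rewrite /reduced /winv rev_sorted sorted_map.
apply: sub_sorted => l l' /=; apply: contraNneq => e.
by rewrite e linvK.
Qed.

Lemma reduce_winvl w : reduce (winv w ++ w) = [::].
Proof.
elim: w => //= l w IH; rewrite /winv /= rev_cons cat_rcons.
rewrite /reduce foldr_cat /= -/(reduce w).
have := @lconsK (linv l) (reduce w) (reduce_reduced w); rewrite linvK => ->.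
by rewrite /reduce -foldr_cat; exact: IH.
Qed.

Definition freegroup : Type := {w : seq letter | reduced w}.
HB.instance Definition _ := Choice.on freegroup.
HB.instance Definition _ := SubType.on freegroup.

Definition fg_one : freegroup := exist _ [::] isT.
Definition fg_mul (u v : freegroup) : freegroup :=
  exist _ (reduce (val u ++ val v)) (reduce_reduced _).
Definition fg_inv (u : freegroup) : freegroup :=
  exist _ (winv (val u)) (winv_reduced (valP u)).

Lemma fg_mulA : associative fg_mul.
Proof.
by move=> u v w; apply: val_inj; rewrite /= reduce_catl reduce_catr catA.
Qed.

Lemma fg_mul1g : left_id fg_one fg_mul.
Proof. by move=> u; apply: val_inj; rewrite /= reduce_id //; apply: valP. Qed.

Lemma fg_mulg1 : right_id fg_one fg_mul.
Proof.
by move=> u; apply: val_inj; rewrite /= cats0 reduce_id //; apply: valP.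
Qed.

Lemma fg_mulVg : left_inverse fg_one fg_inv fg_mul.
Proof. by move=> u; apply: val_inj; rewrite /= reduce_winvl. Qed.

Lemma fg_mulgV : right_inverse fg_one fg_inv fg_mul.
Proof.
move=> u; have invK : fg_inv (fg_inv u) = u.
  apply: val_inj; rewrite /= /winv map_rev revK -map_comp map_id_in //.
  by move=> l _ /=; exact: linvK.
by rewrite -{1}invK fg_mulVg.
Qed.

HB.instance Definition _ :=
  isGroup.Build freegroup fg_mulA fg_mul1g fg_mulg1 fg_mulVg fg_mulgV.

Definition fgen (x : X) : freegroup := exist _ [:: (x, false)] isT.

Definition positive (w : freegroup) := all (fun l => ~~ l.2) (val w).

(* x or x^-1 appears in the reduced word w. *)
Definition occurs (x : X) (w : freegroup) := has (fun l => l.1 == x) (val w).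

End FreeGroup.

(* The free group on a and b, indexed by false and true respectively. *)
Definition F2 := freegroup bool.
Definition gen_a : F2 := fgen false.
Definition gen_b : F2 := fgen true.

Local Open Scope ring_scope.

(* Homeo^+(S^1)^~, with composition as group law. *)
Section HomeoLift.
Variable R : realType.

Record homeo_lift := HomeoLift {
  lift_fun :> R -> R;
  lift_inv : R -> R;
  lift_funK : cancel lift_fun lift_inv;
  lift_invK : cancel lift_inv lift_fun;
  lift_fun_continuous : continuous lift_fun;
  lift_inv_continuous : continuous lift_inv;
  lift_fun_increasing : {homo lift_fun : x y / x < y};
  lift_funD1 : forall x, lift_fun (x + 1) = lift_fun x + 1
}.

Lemma homeo_lift_eq (f g : homeo_lift) : f =1 g -> f = g.
Proof.
case: f g => [f f' fK f'K fc f'c fi f1] [g g' gK g'K gc g'c gi g1] /= /funext fg.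
subst g; have e : f' = g'.
  by apply: funext => x; apply: (can_inj fK); rewrite f'K g'K.
by subst g'; congr HomeoLift; exact: Prop_irrelevance.
Qed.

HB.instance Definition _ := gen_eqMixin homeo_lift.
HB.instance Definition _ := gen_choiceMixin homeo_lift.

Definition lift_one : homeo_lift.
Proof.
by refine (@HomeoLift id id _ _ _ _ _ _) => // x; exact: cvg_id.
Defined.

Definition lift_mul (f g : homeo_lift) : homeo_lift.
Proof.
refine (@HomeoLift (f \o g) (lift_inv g \o lift_inv f) _ _ _ _ _ _).
- by apply: can_comp; exact: lift_funK.
- by apply: can_comp; exact: lift_invK.
- by move=> x; apply: continuous_comp; exact: lift_fun_continuous.
- by move=> x; apply: continuous_comp; exact: lift_inv_continuous.
- by move=> x y xy /=; do 2 apply: lift_fun_increasing.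
- by move=> x /=; rewrite !lift_funD1.
Defined.

Definition lift_V (f : homeo_lift) : homeo_lift.
Proof.
refine (@HomeoLift (lift_inv f) f (@lift_invK f) (@lift_funK f)
  (@lift_inv_continuous f) (@lift_fun_continuous f) _ _).
- move=> x y xy; rewrite ltNge; apply/negP; rewrite le_eqVlt => /orP[/eqP e|].
    by move: xy; rewrite -(lift_invK f x) -e lift_invK ltxx.
  by move/(@lift_fun_increasing f); rewrite !lift_invK ltNge (ltW xy).
- by move=> x; apply: (can_inj (@lift_funK f)); rewrite lift_funD1 !lift_invK.
Defined.

Lemma lift_mulA : associative lift_mul.
Proof. by move=> f g h; exact: homeo_lift_eq. Qed.

Lemma lift_mul1g : left_id lift_one lift_mul.
Proof. by move=> f; exact: homeo_lift_eq. Qed.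

Lemma lift_mulg1 : right_id lift_one lift_mul.
Proof. by move=> f; exact: homeo_lift_eq. Qed.

Lemma lift_mulVg : left_inverse lift_one lift_V lift_mul.
Proof. by move=> f; apply: homeo_lift_eq => x /=; exact: lift_funK. Qed.

Lemma lift_mulgV : right_inverse lift_one lift_V lift_mul.
Proof. by move=> f; apply: homeo_lift_eq => x /=; exact: lift_invK. Qed.

HB.instance Definition _ := isGroup.Build homeo_lift
  lift_mulA lift_mul1g lift_mulg1 lift_mulVg lift_mulgV.

(* The limit of (f^n(x) - x) / n exists and does not depend on x: take x = 0. *)
Definition rotnum (f : homeo_lift) : R := limn (fun n => iter n f 0 / n%:R).

(* R(w, r, s); the set below is nonempty (take translations) and bounded, for
   all w, r and s, so sup is its actual supremum. *)
Definition maxrot (w : F2) (r s : R) : R :=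
  sup [set rotnum (rho w) | rho in
        [set rho : {multiplicative F2 -> homeo_lift} |
          rotnum (rho gen_a) = r /\ rotnum (rho gen_b) = s]].

End HomeoLift.

Local Close Scope ring_scope.
Local Open Scope nat_scope.

(* Algorithms: partial recursive functions of Kleene. The arguments are given
   as a sequence, and the arguments beyond its end are 0. *)
Inductive murec : Type :=
| MZero
| MSucc
| MProj of nat
| MComp of murec & seq murec
| MRec of murec & murec
| MMin of murec.

Inductive computes : murec -> seq nat -> nat -> Prop :=
| computes_zero xs : computes MZero xs 0
| computes_succ xs : computes MSucc xs (nth 0 xs 0).+1
| computes_proj i xs : computes (MProj i) xs (nth 0 xs i)
| computes_comp f gs xs ys y :
    computes_all gs xs ys -> computes f ys y -> computes (MComp f gs) xs y
| computes_rec0 f g xs y :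
    computes f xs y -> computes (MRec f g) (0 :: xs) y
| computes_recS f g n xs z y :
    computes (MRec f g) (n :: xs) z -> computes g (n :: z :: xs) y ->
    computes (MRec f g) (n.+1 :: xs) y
| computes_min f xs n (k : nat -> nat) :
    (forall m, m < n -> computes f (m :: xs) (k m).+1) ->
    computes f (n :: xs) 0 -> computes (MMin f) xs n
with computes_all : seq murec -> seq nat -> seq nat -> Prop :=
| computes_nil xs : computes_all [::] xs [::]
| computes_cons g gs xs y ys :
    computes g xs y -> computes_all gs xs ys ->
    computes_all (g :: gs) xs (y :: ys).

Definition int_code (z : int) : nat :=
  match z with Posz n => n.*2 | Negz n => n.*2.+1 end.

Definition letter_code (l : bool * bool) : nat := l.1 + l.2.*2.

Definition word_code (w : F2) : nat := CodeSeq.code (map letter_code (val w)).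

Definition frac_code (u : int) (v : nat) : nat :=
  CodeSeq.code [:: int_code u; v].

(* Main.v *)
From HB Require Import structures.
Require Import Defs.
From mathcomp Require Import all_boot all_order all_algebra.
From mathcomp Require Import all_classical all_reals all_analysis.
From mathcomp Require Import zify ring lra.

(* Write f, g for the images of a, b. If w^d(y) >= y + c, an orbit of y has finitely
   many points and each of them is located by two integers: its position H with
   respect to an orbit of f of period q, and its position K with respect to an
   orbit of period v of a monotone degree one map below g. The orbit forces H to
   grow by at most p along an a, and K by at most u along a b. Conversely such a
   combinatorial orbit ("certificate") is realized by homeomorphisms with rotation
   numbers p/q and any s >= u/v, after drawing the points (H/q, K/v) on a monotone
   staircase and pushing f and g up away from one periodic orbit.
   Since v is at most the number of letters of w^d, one denominator D serves all
   certificates, and R(w, p/q, t) >= c/d iff a certificate exists for some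
   u/D <= t. So the infimum is u/D for the least certifiable u; certificates of
   bounded size suffice, which makes this u computable by a search. *)

Set Implicit Arguments.
Unset Strict Implicit.
Unset Printing Implicit Defensive.

Import Order.TTheory GRing.Theory Num.Theory numFieldNormedType.Exports.

Local Open Scope classical_set_scope.
Local Open Scope ring_scope.


(** [maxrot] is a supremum, so the equality R(w, p/q, t) = c/d does not by itself provide an orbit
    to read a certificate from. The obstacle is removed by rounding f up to a monotone map F with q
    values modulo 1 and the same potential. Evaluated in F and g, a cyclic rotation of w in which an
    a acts last has only q values modulo 1, hence an orbit of period d' <= q. The certificate of
    that orbit is realized with the original rotation numbers, so every rot(rho(w)) is at most some
    e/d' with d' <= q, which is itself at most another such value. These fractions cannot accumulate
    at c/d from below, so the supremum is reached, and d <= q follows. Monotonicity of R in t is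
    likewise read off from the freedom of s >= u/v in the realization. Positions are only weakly
    monotone along the line, which is why the order condition of a certificate derives a weak
    inequality for K from a strict one for H. The projections of a staircase may be constant on
    intervals; contracting them slightly gives homeomorphisms, at the cost of an error that the
    margin of the pushed lifts absorbs. *)

(** * Rotation numbers of lifts and monotone maps of degree one *)

Section Rotation.
Variable R : realType.
Implicit Types (f g h : homeo_lift R) (F G : R -> R) (x y r s : R).

Lemma le0_archi x (C : R) : (forall n : nat, n%:R * x <= C) -> x <= 0.
Proof.
move=> h; rewrite leNgt; apply/negP => x0.
have [n] : exists n : nat, C / x < n%:R.
  exists (Num.bound `|C / x|).
  exact: le_lt_trans (ler_norm _) (archi_boundP (normr_ge0 _)).
by rewrite ltr_pdivrMr // ltNge h.
Qed.

(** Continuity is left out because the rounded maps used later are step functions. *)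
Definition degree_one F :=
  {homo F : x y / x <= y} /\ forall x, F (x + 1) = F x + 1.

Lemma degree_oneDz F x (m : int) : degree_one F -> F (x + m%:~R) = F x + m%:~R.
Proof.
move=> [_ F1].
have Fn y (n : nat) : F (y + n%:R) = F y + n%:R.
  elim: n => [|n IH]; first by rewrite !addr0.
  by rewrite -natr1 addrA F1 IH addrA.
case: m => n; first exact: Fn.
rewrite NegzE mulrNz /= -pmulrn.
by apply: (addIr n.+1%:R); rewrite -Fn !subrK.
Qed.

Lemma degree_one_comp F G : degree_one F -> degree_one G -> degree_one (F \o G).
Proof.
by move=> [Fm F1] [Gm G1]; split=> [x y xy|x] /=; [apply/Fm/Gm | rewrite G1 F1].
Qed.

Lemma degree_one_iter F n : degree_one F -> degree_one (iter n F).
Proof.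
move=> dF; elim: n => [|n IH]; first by split.
exact: degree_one_comp.
Qed.

Lemma degree_one_lift f : degree_one f.
Proof.
split; last exact: lift_funD1.
by move=> x y; rewrite le_eqVlt => /orP[/eqP->//|/(@lift_fun_increasing _ f)/ltW].
Qed.

Lemma int_itv x : exists m : int, m%:~R <= x < m%:~R + 1.
Proof. by exists (Num.floor x); have := floor_itv x; rewrite intrD. Qed.

Lemma degree_one_disp F x y : degree_one F -> `|F x - x - (F y - y)| <= 1.
Proof.
move=> dF; have [Fm _] := dF.
have [m /andP[m1 m2]] := int_itv (x - y).
have /Fm : y + m%:~R <= x by lra.
have /Fm : x <= y + m%:~R + 1 by lra.
rewrite dF.2 !(degree_oneDz _ _ dF) => l1 l2.
by rewrite ler_norml; apply/andP; split; lra.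
Qed.

Lemma degree_one_iterM F n m : degree_one F ->
  `|iter (m * n) F 0 - m%:R * iter n F 0| <= m%:R.
Proof.
move=> dF; elim: m => [|m IH]; first by rewrite mul0r subrr normr0.
rewrite mulSn iterD -natr1.
have := degree_one_disp (iter (m * n) F 0) 0 (degree_one_iter n dF).
move: IH; rewrite !ler_norml => /andP[? ?] /andP[? ?].
by apply/andP; split; lra.
Qed.

(** Comparing the iterate of order ij with j blocks of length i and with i blocks of length j puts
    every (a_i - 1)/i below every (a_j + 1)/j. The supremum of the former approximates each a_n/n
    with error 1/n, so it is the limit. *)
Lemma rotnum_orbit0 f n : `|iter n f 0 - n%:R * rotnum f| <= 1.
Proof.
pose a n := iter n f 0; have df := degree_one_lift f.
have aM i j : (0 < i)%N -> (0 < j)%N -> (a i - 1) / i%:R <= (a j + 1) / j%:R.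
  move=> i0 j0; rewrite ler_pdivrMr ?ltr0n // mulrAC ler_pdivlMr ?ltr0n //.
  have := degree_one_iterM i j df; have := degree_one_iterM j i df.
  rewrite mulnC -/(a i) -/(a j) !ler_norml => /andP[? ?] /andP[? ?].
  by lra.
pose A := [set (a i.+1 - 1) / i.+1%:R | i in [set: nat]].
have supA : has_sup A.
  split; first by exists ((a 1 - 1) / 1); exists 0%N.
  by exists ((a 1 + 1) / 1) => _ [i _ <-]; exact: aM.
have lo i : a i.+1 - 1 <= i.+1%:R * sup A.
  rewrite mulrC -ler_pdivrMr ?ltr0n //; apply: sup_upper_bound => //.
  by exists i.
have hi i : i.+1%:R * sup A <= a i.+1 + 1.
  rewrite mulrC -ler_pdivlMr ?ltr0n //; apply: ge_sup; first by case: supA.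
  by move=> _ [j _ <-]; exact: aM.
have bnd i : `|a i - i%:R * sup A| <= 1.
  case: i => [|i]; first by rewrite mul0r subrr normr0.
  by rewrite ler_norml; apply/andP; split; have := lo i; have := hi i; lra.
suff -> : rotnum f = sup A by exact: bnd.
apply: cvg_lim => //; apply/cvgrPdist_le => e e0.
near=> i.
have i0 : (0 < i)%N by near: i; exists 1%N.
have -> : sup A - iter i f 0 / i%:R = (i%:R * sup A - a i) / i%:R.
  by rewrite mulrBl mulrAC mulfV ?mul1r // pnatr_eq0 -lt0n.
rewrite normrM normfV (ger0_norm (ler0n _ _)) ler_pdivrMr ?ltr0n // distrC.
apply: le_trans (bnd i) _; rewrite mulrC -ler_pdivrMr //.
near: i; exact: nbhs_infty_ger.
Unshelve. all: by end_near.
Qed.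

Lemma rotnum_orbit f x n : `|iter n f x - x - n%:R * rotnum f| <= 2.
Proof.
have := rotnum_orbit0 f n.
have := degree_one_disp x 0 (degree_one_iter n (degree_one_lift f)).
rewrite !ler_norml => /andP[? ?] /andP[? ?].
by apply/andP; split; lra.
Qed.

Lemma rotnum_unique f x r (C : R) :
  (forall n, `|iter n f x - n%:R * r| <= C) -> rotnum f = r.
Proof.
move=> h.
have b n : `|n%:R * (rotnum f - r)| <= C + 2 + `|x|.
  have := h n; have := rotnum_orbit f x n; have := lexx `|x|.
  rewrite !ler_norml => /andP[? ?] /andP[? ?] /andP[? ?].
  by apply/andP; split; lra.
apply/eqP; rewrite eq_le -subr_le0 -[r <= _]subr_le0.
apply/andP; split; apply: (@le0_archi _ (C + 2 + `|x|)) => n.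
  exact: le_trans (ler_norm _) (b n).
by apply: le_trans (b n); rewrite -(opprB (rotnum f)) mulrN -normrN ler_norm.
Qed.

Lemma rotnum_ge f d (c : int) x : (0 < d)%N -> x + c%:~R <= iter d f x ->
  c%:~R / d%:R <= rotnum f.
Proof.
move=> d0 h; have df := degree_one_iter d (degree_one_lift f).
have hn n : x + n%:R * c%:~R <= iter (n * d) f x.
  elim: n => [|n IH]; first by rewrite mul0r addr0.
  rewrite mulSn iterD -natr1; apply: le_trans (df.1 _ _ IH).
  have -> : n%:R * c%:~R = ((n%:Z * c)%:~R : R) by rewrite intrM.
  by rewrite degree_oneDz // intrM /=; lra.
rewrite ler_pdivrMr ?ltr0n // -subr_le0; apply: (@le0_archi _ 2) => n.
have := hn n; have := rotnum_orbit f x (n * d); rewrite natrM.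
by rewrite ler_norml => /andP[? ?] ?; lra.
Qed.

Lemma rotnum_le f d (c : int) x : (0 < d)%N -> iter d f x <= x + c%:~R ->
  rotnum f <= c%:~R / d%:R.
Proof.
move=> d0 h; have df := degree_one_iter d (degree_one_lift f).
have hn n : iter (n * d) f x <= x + n%:R * c%:~R.
  elim: n => [|n IH]; first by rewrite mul0r addr0.
  rewrite mulSn iterD -natr1; apply: le_trans (df.1 _ _ IH) _.
  have -> : n%:R * c%:~R = ((n%:Z * c)%:~R : R) by rewrite intrM.
  by rewrite degree_oneDz // intrM /=; lra.
rewrite ler_pdivlMr ?ltr0n // -subr_le0; apply: (@le0_archi _ 2) => n.
have := hn n; have := rotnum_orbit f x (n * d); rewrite natrM.
by rewrite ler_norml => /andP[? ?] ?; lra.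
Qed.

(** If every point moved by less than c under f^d, the continuous periodic displacement would have a
    maximum below c, and this uniform deficit would force the rotation number below c/d. *)
Lemma rotnum_ge_point f d (c : int) : (0 < d)%N -> c%:~R / d%:R <= rotnum f ->
  exists y, y + c%:~R <= iter d f y.
Proof.
move=> d0 h; apply: contrapT => /forallNP nP.
pose u y : R := iter d f y - y.
have cit n : continuous (iter n f).
  elim: n => [|n IH] x; first exact: cvg_id.
  by apply: continuous_comp; [exact: IH | exact: lift_fun_continuous].
have cu : {within `[0, 1], continuous u}.
  apply: continuous_subspaceT => x; apply: cvgB; first exact: cit.
  exact: cvg_id.
have [y _ ymax] := EVT_max (@ler01 R) cu.
have uy x : u x <= u y.
  have df := degree_one_iter d (degree_one_lift f).
  have [m /andP[x0 x1]] := int_itv x.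
  have -> : u x = u (x + (- m)%:~R) by rewrite /u degree_oneDz // mulrNz; lra.
  by apply: ymax; rewrite in_itv /= mulrNz; apply/andP; split; lra.
have uyc : u y < c%:~R by have /negP := nP y; rewrite -ltNge /u; lra.
have it n : iter (n * d) f 0 <= n%:R * u y.
  elim: n => [|n IH]; first by rewrite mul0r.
  by rewrite mulSn iterD -natr1; have := uy (iter (n * d) f 0); rewrite /u in IH *; lra.
have : rotnum f * d%:R - u y <= 0.
  apply: (@le0_archi _ 1) => n; have := it n.
  by have := rotnum_orbit0 f (n * d); rewrite natrM ler_norml => /andP[? ?]; lra.
by move: h; rewrite ler_pdivrMr ?ltr0n //; lra.
Qed.

End Rotation.


(** * Homeomorphisms close to the identity and Lipschitz extension on the circle *)

Section Perturbation.
Variable R : realType.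
Implicit Types (x y : R).

Lemma lipschitz_continuous (F : R -> R) (k : R) :
  (forall x y, `|F x - F y| <= k * `|x - y|) -> continuous F.
Proof.
move=> Fk x; apply/cvgrPdist_le => e e0.
have k0 : 0 < `|k| + 1 by rewrite ltr_wpDl.
near=> y; apply: le_trans (Fk x y) _.
apply: (@le_trans _ _ ((`|k| + 1) * `|x - y|)).
  by apply: ler_wpM2r => //; apply: le_trans (ler_norm k) _; rewrite lerDl.
rewrite mulrC -ler_pdivlMr //; near: y.
by apply: cvgr_dist_le; [exact: cvg_id | rewrite divr_gt0].
Unshelve. all: by end_near.
Qed.

(** With Lipschitz constant k < 1 for [sigma], the map x + sigma(x) stretches distances by at least
    1 - k: it is injective, onto by the intermediate value theorem, and has a Lipschitz inverse. *)
Lemma lift_of_perturbation (sigma : R -> R) (k : R) : k < 1 ->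
  (forall x y, `|sigma x - sigma y| <= k * `|x - y|) ->
  (forall x, sigma (x + 1) = sigma x) ->
  exists f : homeo_lift R, f =1 (fun x => x + sigma x).
Proof.
move=> k1 sk s1; pose F x := x + sigma x.
have expand x y : x <= y -> (1 - k) * (y - x) <= F y - F x.
  move=> xy; have := sk y x; rewrite (ger0_norm (_ : 0 <= y - x)) ?subr_ge0 //.
  by rewrite ler_norml /F => /andP[? ?]; lra.
have Fc : continuous F.
  apply: (@lipschitz_continuous _ (1 + k)) => x y.
  rewrite /F mulrDl mul1r.
  have -> : x + sigma x - (y + sigma y) = x - y + (sigma x - sigma y) by ring.
  by apply: le_trans (ler_normD _ _) _; rewrite lerD2l.
have Finj x y : F x = F y -> x = y.
  wlog xy : x y / x <= y.
    by move=> h; case/orP: (le_total x y) => [/h//|/h h' /esym /h' ->].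
  move=> e; have := expand _ _ xy; rewrite e subrr pmulr_rle0 ?subr_gt0 // => ?.
  by apply/eqP; rewrite eq_le xy -subr_le0.
have Fincr : {homo F : x y / x < y}.
  move=> x y xy; rewrite -subr_gt0; apply: lt_le_trans (expand _ _ (ltW xy)).
  by rewrite mulr_gt0 // subr_gt0.
have F1 x : F (x + 1) = F x + 1 by rewrite /F s1; ring.
have Fsurj z : exists x, F x = z.
  pose c := (`|z - F 0|) / (1 - k).
  have k0 : 0 < 1 - k by rewrite subr_gt0.
  have c0 : 0 <= c by rewrite divr_ge0 // ltW.
  have ck : (1 - k) * c = `|z - F 0| by rewrite mulrC divfK // gt_eqF.
  have [|||x _ <-] := @IVT R F (- c) c z; last by exists x.
  - lra.
  - by apply: continuous_subspaceT.
  - have e2 := expand 0 c c0.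
    have /expand e1 : - c <= 0 by lra.
    have l : F (- c) <= z <= F c.
      move: e1 e2; rewrite subr0 sub0r opprK ck => ? ?.
      have := lexx (`|z - F 0|); rewrite {1}ler_norml => /andP[? ?].
      by apply/andP; split; lra.
    have m : F (- c) <= F c by case/andP: l; apply: le_trans.
    by rewrite (min_idPl m) (max_idPr m).
have [G FG] := choice Fsurj.
have GF : cancel F G by move=> x; apply: Finj; rewrite FG.
have Gc : continuous G.
  apply: (@lipschitz_continuous _ ((1 - k)^-1)) => x y.
  wlog xy : x y / G x <= G y.
    by move=> h; case/orP: (le_total (G x) (G y)) => [/h//|/h];
       rewrite distrC (distrC x).
  have := expand _ _ xy; rewrite !FG => e.
  rewrite distrC (distrC x) (ger0_norm (_ : 0 <= G y - G x)) ?subr_ge0 //.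
  rewrite mulrC ler_pdivlMr ?subr_gt0 // mulrC.
  exact: le_trans e (ler_norm _).
by exists (HomeoLift GF FG Fc Gc Fincr F1).
Qed.

(* McShane's extension theorem for 1-Lipschitz functions on the circle. *)
Lemma periodic_lipschitz_extension (I : Type) (i0 : I) (Y Z : I -> R) :
  (forall i j (m : int), `|Z i - Z j| <= `|Y i - Y j - m%:~R|) ->
  exists z : R -> R, [/\ forall x y, `|z x - z y| <= `|x - y|,
    forall x, z (x + 1) = z x & forall i, z (Y i) = Z i].
Proof.
move=> YZ.
(* The cones stand at all integer translates of the [Y i], which makes their lower envelope
   periodic. *)
pose A x := [set Z im.1 + `|x - Y im.1 - im.2%:~R| | im in [set: I * int]].
have A0 x : A x !=set0 by exists (Z i0 + `|x - Y i0 - 0%:~R|); exists (i0, 0).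
have lbA x i : lbound (A x) (Z i - `|x - Y i|).
  move=> _ [[j m] _ <-] /=.
  have := YZ i j m; have := ler_norm (Z i - Z j).
  have := ler_normD (- (x - Y i)) (x - Y j - m%:~R).
  rewrite normrN.
  have -> : - (x - Y i) + (x - Y j - m%:~R) = Y i - Y j - m%:~R by ring.
  lra.
have hA x : has_inf (A x) by split=> //; exists (Z i0 - `|x - Y i0|).
have le1 x y : inf (A x) <= inf (A y) + `|x - y|.
  rewrite -lerBlDr; apply: lb_le_inf => // _ [[i m] _ <-] /=.
  rewrite lerBlDr.
  apply: le_trans (_ : Z i + `|x - Y i - m%:~R| <= _).
    by apply: inf_lbound; [exact: (hA x).2 | exists (i, m)].
  rewrite -[leRHS]addrA lerD2l.
  have -> : x - Y i - m%:~R = (y - Y i - m%:~R) + (x - y) by ring.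
  exact: ler_normD.
exists (fun x => inf (A x)); split.
- move=> x y; rewrite ler_norml; have := le1 x y; have := le1 y x.
  by rewrite (distrC y) => ? ?; apply/andP; split; lra.
- move=> x; congr inf; apply/seteqP; split=> _ [[i m] _ <-] /=.
    by exists (i, m - 1) => //=; congr (_ + `|_|); rewrite intrB; ring.
  by exists (i, m + 1) => //=; congr (_ + `|_|); rewrite intrD; ring.
- move=> i; apply/eqP; rewrite eq_le; apply/andP; split.
    apply: inf_lbound; first exact: (hA _).2.
    by exists (i, 0) => //=; rewrite subrr subr0 normr0 addr0.
  by have := lb_le_inf (A0 (Y i)) (lbA (Y i) i); rewrite subrr normr0 subr0.
Qed.

End Perturbation.


(** * Lifts of given rotation number that push a periodic grid upwards *)

Section PushingLifts.
Variable R : realType.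
Implicit Types (f g h : homeo_lift R) (x y r s : R).

Lemma periodicDz (F : R -> R) x (m : int) :
  (forall x, F (x + 1) = F x) -> F (x + m%:~R) = F x.
Proof.
move=> F1.
have Fn y (n : nat) : F (y + n%:R) = F y.
  elim: n => [|n IH]; first by rewrite addr0.
  by rewrite -natr1 addrA F1.
case: m => n; first exact: Fn.
by rewrite NegzE mulrNz /= -pmulrn -[LHS](Fn _ n.+1) subrK.
Qed.

Lemma rotnum_conj f h : rotnum (h^-1 * f * h)%g = rotnum f.
Proof.
set h' := (h^-1)%g.
have hK x : h (h' x) = x by exact: lift_invK.
have it n : iter n (h' * f * h)%g (h' 0) = h' (iter n f 0).
  by elim: n => //= n ->; rewrite hK.
apply: (@rotnum_unique _ _ (h' 0) _ (2 + `|h' 0|)) => n; rewrite it.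
have := degree_one_disp (iter n f 0) 0 (degree_one_lift h').
have := rotnum_orbit0 f n; have := lexx `|h' 0|.
rewrite !ler_norml => /andP[? ?] /andP[? ?] /andP[? ?].
by apply/andP; split; lra.
Qed.

(** The margin [delta] lets the push survive small errors in the position. For s = p/q the points (i
    + 1/2)/q form periodic orbits, which fixes the rotation number, while the points i/q are sent
    strictly beyond (i + p)/q. *)
Lemma exists_pushing_lift (p : int) (q : nat) s : (0 < q)%N -> p%:~R / q%:R <= s ->
  exists (f : homeo_lift R) (delta : R), [/\ 0 < delta, rotnum f = s &
    forall (i : int) x, i%:~R / q%:R - delta <= x ->
      (i + p)%:~R / q%:R + delta <= f x].
Proof.
move=> q0; rewrite le_eqVlt => /orP[/eqP <-|ps]; last first.
  have [||f fE] := @lift_of_perturbation R (fun=> s) 0 ltr01 => //.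
    by move=> x y; rewrite subrr normr0 mul0r.
  (* One half of the slack makes up for the delay of [x], the other half is the margin gained. *)
  exists f, ((s - p%:~R / q%:R) / 2); split; first by rewrite divr_gt0 // subr_gt0.
    apply: (@rotnum_unique _ _ 0 _ 0) => n.
    suff -> : iter n f 0 = n%:R * s by rewrite subrr normr0.
    by elim: n => [|n IH]; rewrite ?mul0r //= fE IH -natr1; ring.
  by move=> i x; rewrite fE intrD mulrDl; lra.
have q0' : 0 < q%:R :> R by rewrite ltr0n.
pose Y (b : bool) : R := if b then 2^-1 else 0.
pose Z (b : bool) : R := if b then 0 else 2^-1.
have [|z [zl z1 zY]] := @periodic_lipschitz_extension R bool true Y Z.
  have half (m : int) : 2^-1 <= `|2^-1 - m%:~R : R|.
    have [m0|m0] := leP m 0.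
      have : m%:~R <= 0 :> R by rewrite lerz0.
      by move=> ?; rewrite ger0_norm; lra.
    have : 1 <= m%:~R :> R by rewrite ler1z; lia.
    by move=> ?; rewrite ler0_norm; lra.
  case; case=> m; rewrite /Y /Z ?subrr ?normr0 ?normr_ge0 // ?subr0 ?sub0r //.
    by rewrite normrN ger0_norm // ?half // invr_ge0.
  rewrite ger0_norm ?invr_ge0 // -normrN.
  by have -> : - (- 2^-1 - m%:~R) = 2^-1 - (- m)%:~R :> R by rewrite mulrNz; ring.
pose sigma x := p%:~R / q%:R + z (q%:R * x) / (2 * q%:R).
have [| | |f fE] := @lift_of_perturbation R sigma 2^-1.
- by lra.
- move=> x y; rewrite /sigma.
  rewrite (_ : _ - _ = (z (q%:R * x) - z (q%:R * y)) / (2 * q%:R)); last by lra.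
  rewrite normrM normfV (ger0_norm (_ : 0 <= 2 * q%:R)) ?mulr_ge0 //.
  rewrite ler_pdivrMr ?mulr_gt0 //; apply: le_trans (zl _ _) _.
  by rewrite -mulrBr normrM ger0_norm //; lra.
- by move=> x; rewrite /sigma mulrDr mulr1 (periodicDz _ q%:Z).
(* For delta = e/q the push at i/q - delta is at least (1/2 - e)/(2q). It has to cover 2 delta, once
   for the delay and once for the margin; e = 1/10 is the largest solution. *)
exists f, ((10 * q%:R)^-1); split.
- by rewrite invr_gt0 mulr_gt0.
- apply: (@rotnum_unique _ _ (2 * q%:R)^-1 _ `|(2 * q%:R)^-1|) => n.
  suff -> : iter n f (2 * q%:R)^-1 = (2 * q%:R)^-1 + n%:R * (p%:~R / q%:R).
    by rewrite addrK.
  elim: n => [|n IH]; first by rewrite mul0r addr0.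
  rewrite /= IH fE /sigma.
  have -> : q%:R * ((2 * q%:R)^-1 + n%:R * (p%:~R / q%:R)) = 2^-1 + (n%:Z * p)%:~R :> R.
    by rewrite intrM /=; field; lra.
  by rewrite periodicDz // (zY true) mul0r addr0 -natr1; ring.
- move=> i x ix.
  apply: le_trans (_ : f (i%:~R / q%:R - (10 * q%:R)^-1) <= _); last first.
    exact: (degree_one_lift f).1.
  rewrite fE /sigma intrD.
  have -> : q%:R * (i%:~R / q%:R - (10 * q%:R)^-1) = - 10^-1 + i%:~R :> R.
    by field; lra.
  rewrite periodicDz //.
  have n10 : `|- 10^-1 - 0| = 10^-1 :> R by rewrite subr0 normrN ger0_norm ?invr_ge0.
  have := zl (- 10^-1) 0; rewrite n10 (zY false : z 0 = 2^-1) ler_norml.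
  move=> /andP[zlow _].
  have : (4 / 10) / (2 * q%:R) <= z (- 10^-1) / (2 * q%:R).
    by rewrite ler_pM2r ?invr_gt0 ?mulr_gt0 //; lra.
  have -> : 4 / 10 / (2 * q%:R) = 2 * (10 * q%:R)^-1 :> R by field; lra.
  by lra.
Qed.

Definition word_act (T : Type) (F G : T -> T) (l : seq bool) (y : T) : T :=
  foldr (fun b => if b then G else F) y l.

(** For monotone maps a chain of one-step inequalities is as good as an orbit; this is why a
    certificate consists of inequalities only. *)
Lemma word_act_ge (F G : R -> R) (l : seq bool) (Y : nat -> R) :
  {homo F : x y / x <= y} -> {homo G : x y / x <= y} ->
  (forall k, (k < size l)%N ->
    Y k <= (if nth false l k then G else F) (Y k.+1)) ->
  Y 0%N <= word_act F G l (Y (size l)).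
Proof.
move=> Fm Gm; elim: l Y => //= b l IH Y hY.
apply: le_trans (hY 0%N isT) _ => /=.
have := IH (fun k => Y k.+1) (fun k kl => hY k.+1 kl).
by case: b {hY}; [apply: Gm | apply: Fm].
Qed.

End PushingLifts.

(* The points of an orbit of the word l, listed from the last to the first, are
   recorded by their combinatorial positions H and K with respect to periodic
   orbits of a and of b. *)
Definition certificate (l : seq bool) (p : int) (q : nat) (u : int) (v : nat)
    (c : int) (H K : nat -> int) : Prop :=
  [/\ forall k, (k < size l)%N ->
        if nth false l k then K k <= K k.+1 + u else H k <= H k.+1 + p,
      forall k j (m : int), (k <= size l)%N -> (j <= size l)%N ->
        H k < H j + m * q%:Z -> K k <= K j + m * v%:Z,
      H (size l) + c * q%:Z <= H 0%N
    & K (size l) + c * v%:Z <= K 0%N].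

(** * From a certificate to homeomorphisms *)

Section CertificateRealization.
Variable R : realType.
Implicit Types (f g h : homeo_lift R) (x y r s : R).

(** In the coordinates Y = (al + be)/2 and Z = (be - al)/2 a monotone staircase becomes the graph of
    a periodic 1-Lipschitz function z. The projections Y - z and Y + z recover H/q and K/v; f and g
    are the pushing lifts conjugated by these projections, once contracted to be invertible. *)
Lemma certificate_realization l p q u v c H K s :
  (0 < q)%N -> (0 < v)%N -> u%:~R / v%:R <= s -> certificate l p q u v c H K ->
  exists f g : homeo_lift R, [/\ rotnum f = p%:~R / q%:R, rotnum g = s &
    exists y : R, y + c%:~R <= word_act f g l y].
Proof.
move=> q0 v0 us [step mono Hend Kend].
have q0' : 0 < q%:R :> R by rewrite ltr0n.
have v0' : 0 < v%:R :> R by rewrite ltr0n.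
pose al k : R := (H k)%:~R / q%:R; pose be k : R := (K k)%:~R / v%:R.
pose Y k : R := (al k + be k) / 2; pose Z k : R := (be k - al k) / 2.
have leH k j m : H k <= H j + m * q%:Z -> al k <= al j + m%:~R.
  rewrite -(ler_int R) intrD intrM => ?.
  by rewrite ler_pdivrMr // mulrDl divfK // gt_eqF.
have leK k j m : K k <= K j + m * v%:Z -> be k <= be j + m%:~R.
  rewrite -(ler_int R) intrD intrM => ?.
  by rewrite ler_pdivrMr // mulrDl divfK // gt_eqF.
have YZ (i j : 'I_(size l).+1) (m : int) : `|Z i - Z j| <= `|Y i - Y j - m%:~R|.
  wlog : i j m / H i <= H j + m * q%:Z.
    move=> w; have [|Hlt] := leP (H i) (H j + m * q%:Z); first exact: w.
    have := w j i (- m); rewrite (distrC (Z j)) -[`|Y j - _ - _|]normrN mulrNz.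
    have -> : - (Y j - Y i - - m%:~R) = Y i - Y j - m%:~R by ring.
    by apply; lia.
  (* On a tie of [H] the two points span a vertical segment, which has slope one in the new
     coordinates, so [K] needs no constraint. *)
  rewrite le_eqVlt => /orP[/eqP e|Hlt].
    have a1 : al i = al j + m%:~R.
      by rewrite /al e intrD intrM mulrDl mulfK // gt_eqF.
    suff -> : Z i - Z j = Y i - Y j - m%:~R by [].
    by rewrite /Y /Z a1; lra.
  have a1 := leH _ _ _ (ltW Hlt).
  have b1 := leK _ _ _ (mono i j m (ltn_ord i) (ltn_ord j) Hlt).
  rewrite (ler0_norm (_ : Y i - Y j - m%:~R <= 0)); last by rewrite /Y; lra.
  by rewrite ler_norml /Y /Z; apply/andP; split; lra.
have [z [zl z1 zY]] := periodic_lipschitz_extension ord0 YZ.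
have zY' k : (k <= size l)%N -> z (Y k) = Z k.
  by move=> kl; have := zY (Ordinal (kl : (k < (size l).+1)%N)).
have [phi [d1 [d10 rphi phiP]]] := @exists_pushing_lift R p q _ q0 (lexx _).
have [psi [d2 [d20 rpsi psiP]]] := @exists_pushing_lift R u v s v0 us.
pose d := Num.min d1 d2; pose C := \sum_(k < (size l).+1) `|Z k|.
have d0 : 0 < d by rewrite lt_min d10.
have C0 : 0 <= C by apply: sumr_ge0.
have ZC k : (k <= size l)%N -> `|Z k| <= C.
  move=> kl; rewrite /C (bigD1 (Ordinal (kl : (k < (size l).+1)%N))) //= lerDl.
  exact: sumr_ge0.
(* Replacing z by (1 - eta) z makes the projections invertible and moves them by eta |Z k| <= d,
   which fits in both margins. *)
pose eta := d / (d + C + 1).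
have den0 : 0 < d + C + 1 by lra.
have eta0 : 0 < eta by rewrite divr_gt0.
have eta1 : eta <= 1 by rewrite ler_pdivrMr //; lra.
have etaC : eta * C <= d.
  by rewrite mulrAC ler_pdivrMr // ler_wpM2l ?ltW //; lra.
have etaZ k : (k <= size l)%N -> - d <= eta * Z k <= d.
  move=> kl; rewrite -ler_norml normrM (ger0_norm (ltW eta0)).
  by apply: le_trans etaC; apply: ler_wpM2l; [exact: ltW | exact: ZC].
have lip e : `|e| = 1 - eta -> forall x y, `|e * z x - e * z y| <= (1 - eta) * `|x - y|.
  move=> ee x y; rewrite -mulrBr normrM ee ler_wpM2l //; lra.
have [|||A AE] := @lift_of_perturbation R (fun x => - (1 - eta) * z x) (1 - eta).
- by lra.
- by apply: lip; rewrite normrN ger0_norm //; lra.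
- by move=> x; rewrite z1.
have [|||B BE] := @lift_of_perturbation R (fun x => (1 - eta) * z x) (1 - eta).
- by lra.
- by apply: lip; rewrite ger0_norm //; lra.
- by move=> x; rewrite z1.
have AY k : (k <= size l)%N -> al k - d1 <= A (Y k) <= al k + d1.
  move=> kl; have := etaZ k kl; have : d <= d1 by rewrite ge_min lexx.
  rewrite AE zY' // => dd /andP[? ?].
  have -> : Y k + - (1 - eta) * Z k = al k + eta * Z k by rewrite /Y /Z; field.
  by apply/andP; split; lra.
have BY k : (k <= size l)%N -> be k - d2 <= B (Y k) <= be k + d2.
  move=> kl; have := etaZ k kl; have : d <= d2 by rewrite ge_min lexx orbT.
  rewrite BE zY' // => dd /andP[? ?].
  have -> : Y k + (1 - eta) * Z k = be k - eta * Z k by rewrite /Y /Z; field.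
  by apply/andP; split; lra.
pose f := (A^-1 * phi * A)%g; pose g := (B^-1 * psi * B)%g.
exists f, g; split; rewrite ?rotnum_conj //; exists (Y (size l)).
have le_V (h : homeo_lift R) x y : h x <= y -> x <= lift_inv h y.
  move=> hxy; rewrite -[x](lift_funK h).
  exact: (degree_one_lift (h^-1)%g).1.
have stepY k : (k < size l)%N ->
    Y k <= (if nth false l k then g : R -> R else f) (Y k.+1).
  move=> kl; have := step k kl; case: ifP => _ hk; apply: le_V.
    have /andP[_ b1] := BY k (ltnW kl); apply: le_trans b1 _.
    have /andP[b2 _] := BY k.+1 kl; apply: le_trans (psiP _ _ b2).
    by rewrite lerD2r ler_pM2r ?invr_gt0 // ler_int.
  have /andP[_ b1] := AY k (ltnW kl); apply: le_trans b1 _.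
  have /andP[b2 _] := AY k.+1 kl; apply: le_trans (phiP _ _ b2).
  by rewrite lerD2r ler_pM2r ?invr_gt0 // ler_int.
have := word_act_ge (degree_one_lift f).1 (degree_one_lift g).1 stepY.
apply: le_trans.
have a0 : al (size l) + c%:~R <= al 0%N.
  rewrite ler_pdivlMr // mulrDl divfK ?gt_eqF //.
  by move: Hend; rewrite -(ler_int R) intrD intrM.
have b0 : be (size l) + c%:~R <= be 0%N.
  rewrite ler_pdivlMr // mulrDl divfK ?gt_eqF //.
  by move: Kend; rewrite -(ler_int R) intrD intrM.
by rewrite /Y; lra.
Qed.

End CertificateRealization.


(** * Integral potentials and periodic points of monotone maps *)

Section Potential.
Variable R : realType.
Implicit Types (f g h : homeo_lift R) (F G : R -> R) (x y r s : R).

(* A potential is an integral semiconjugacy of q F to the translation by p; it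
   witnesses that the rotation number of F is at most p / q. *)
Definition potential F (p : int) (q : nat) (H : R -> int) :=
  [/\ {homo H : x y / x <= y}, forall x, H (x + 1) = H x + q%:Z &
      forall x, H (F x) <= H x + p].

Lemma potentialDz F p q H x (m : int) : potential F p q H ->
  H (x + m%:~R) = H x + m * q%:Z.
Proof.
move=> [_ H1 _].
have Hn y (n : nat) : H (y + n%:R) = H y + n%:Z * q%:Z.
  elim: n => [|n IH]; first by rewrite !addr0.
  by rewrite -natr1 addrA H1 IH -[n.+1]addn1 PoszD; ring.
case: m => n; first exact: Hn.
rewrite NegzE mulrNz /= -pmulrn.
have := Hn (x - n.+1%:R) n.+1; by rewrite subrK => ->; ring.
Qed.

(** [H x] is the least integer j such that the whole orbit of x stays below the line of slope p/q
    starting at j/q. Dropping the first point of the orbit raises the start of the line by p/q,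
    whence the bound on H (F x). The description of the sublevel sets is what the rounding of f
    relies on. *)
Lemma exists_potential F (p : int) (q : nat) (C : R) : degree_one F ->
  (forall n, q%:R * iter n F 0 <= C + n%:R * p%:~R) ->
  exists2 H, potential F p q H & forall x (j : int),
    H x <= j <-> forall n, q%:R * iter n F x <= j%:~R + n%:R * p%:~R.
Proof.
move=> dF FC.
pose A x := [set q%:R * iter n F x - n%:R * p%:~R | n in [set: nat]].
have A0 x : A x !=set0 by exists (q%:R * iter 0 F x - 0%:R * p%:~R), 0%N.
have supA x : has_sup (A x).
  split=> //; exists (C + q%:R * (1 + `|x|)) => _ [n _ <-].
  have := FC n; have := degree_one_disp x 0 (degree_one_iter n dF).
  rewrite ler_norml => /andP[_ h] hC.
  have : q%:R * iter n F x <= q%:R * (1 + `|x| + iter n F 0).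
    by rewrite ler_wpM2l //; have := ler_norm x; lra.
  by lra.
pose H x := Num.ceil (sup (A x)).
have HP x (j : int) :
    H x <= j <-> forall n, q%:R * iter n F x <= j%:~R + n%:R * p%:~R.
  rewrite /H ceil_le_int; split=> [hj n|hj].
    rewrite -lerBlDr; apply: le_trans hj.
    by apply: sup_upper_bound => //; exists n.
  by apply: ge_sup => // _ [n _ <-]; rewrite lerBlDr.
have H1 x : H (x + 1) = H x + q%:Z.
  have e n : q%:R * iter n F (x + 1) = q%:R * iter n F x + q%:R.
    by rewrite (degree_one_iter n dF).2 mulrDr mulr1.
  apply/eqP; rewrite eq_le -lerBrDr; apply/andP; split; apply/HP => n.
    rewrite e intrD; have := (HP x (H x)).1 (lexx _) n.
    by rewrite -[q%:Z%:~R]pmulrn; lra.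
  rewrite intrB; have := (HP (x + 1) (H (x + 1))).1 (lexx _) n; rewrite e.
  by rewrite -[q%:Z%:~R]pmulrn; lra.
exists H => //; split=> // [x y xy|x]; apply/HP => n.
  apply: le_trans ((HP y (H y)).1 (lexx _) n).
  by rewrite ler_wpM2l //; apply: (degree_one_iter n dF).1.
have := (HP x (H x)).1 (lexx _) n.+1; rewrite iterSr intrD -natr1; lra.
Qed.

Lemma exists_potential_lift f p q : (0 < q)%N -> rotnum f = p%:~R / q%:R ->
  exists2 H, potential f p q H & forall x (j : int),
    H x <= j <-> forall n, q%:R * iter n f x <= j%:~R + n%:R * p%:~R.
Proof.
move=> q0 rf; apply: (@exists_potential _ _ _ q%:R (degree_one_lift f)) => n.
have q0' : 0 < q%:R :> R by rewrite ltr0n.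
have := rotnum_orbit0 f n; rewrite rf ler_norml => /andP[_ h].
have -> : q%:R + n%:R * p%:~R = q%:R * (1 + n%:R * (p%:~R / q%:R)) :> R by field; lra.
by rewrite ler_wpM2l //; lra.
Qed.

Lemma exists_potential_periodic G (v : nat) (u : int) x : (0 < v)%N ->
  degree_one G -> iter v G x = x + u%:~R -> exists H, potential G u v H.
Proof.
move=> v0 dG per.
suff h n : v%:R * iter n G 0 <= (1 + v%:R) + n%:R * u%:~R.
  by have [H ? _] := exists_potential dG h; exists H.
have it : iter (n * v) G x = x + n%:R * u%:~R.
  elim: n => [|n IH]; first by rewrite mul0r addr0.
  have e : n%:R * u%:~R = ((n%:Z * u)%:~R : R) by rewrite intrM.
  rewrite mulSn iterD IH e degree_oneDz; last exact: degree_one_iter.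
  by rewrite per -e -natr1; ring.
have := degree_one_iterM n v dG; rewrite mulnC.
have := degree_one_disp x 0 (degree_one_iter (n * v) dG); rewrite it.
by rewrite !ler_norml => /andP[? ?] /andP[? ?]; lra.
Qed.

(** Pigeonhole on the residues modulo 1 of [#|I| + 1] successive values along the orbit of 0. *)
Lemma exists_periodic_point (I : finType) (V : I -> R) G :
  degree_one G -> (forall x, exists i (m : int), G x = V i + m%:~R) ->
  exists (v : nat) (u : int) x, [/\ (0 < v)%N, (v <= #|I|)%N &
    iter v G x = x + u%:~R].
Proof.
move=> dG GV.
have [i iP] := choice GV; have [m mP] := choice iP.
pose k (j : 'I_#|I|.+1) := i (iter j G 0).
have /injectivePn [a [b ab kab]] : ~~ injectiveb k.
  apply/negP => /injectiveP /leq_card; rewrite card_ord ltnn //.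
wlog {ab} ab : a b kab / (a < b)%N.
  move=> w; have /orP[|] : (a < b)%N || (b < a)%N.
  - by rewrite -neq_ltn.
  - exact: w.
  - by apply: w; rewrite kab.
exists (b - a)%N, (m (iter b G 0) - m (iter a G 0)), (iter a.+1 G 0); split.
- by rewrite subn_gt0.
- by rewrite leq_subLR; have := ltn_ord b; lia.
- rewrite -iterD addnS subnK 1?ltnW // !iterS !mP intrB.
  by move: kab; rewrite /k => ->; ring.
Qed.

End Potential.

(** * From homeomorphisms to certificates, and rounding *)

Section Certificates.
Variable R : realType.
Implicit Types (f g h : homeo_lift R) (F G : R -> R) (x y r s : R).

(* The orbit of y only uses finitely many values of g modulo 1. The least monotone
   degree one map G agreeing with g on these points has a rational rotation number
   u / v, with v bounded, which does not exceed the one of g. *)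
Lemma exists_certificate l p q c F H g y : potential F p q H -> true \in l ->
  y + c%:~R <= word_act F g l y ->
  exists (u : int) (v : nat) Hl Kl, [/\ (0 < v)%N, (v <= size l)%N,
    u%:~R / v%:R <= rotnum g & certificate l p q u v c Hl Kl].
Proof.
move=> potH bl hy; pose Y k := word_act F g (drop k l) y.
have Yend : Y (size l) = y by rewrite /Y drop_size.
have Ystep k : (k < size l)%N ->
    Y k = (if nth false l k then g : R -> R else F) (Y k.+1).
  by move=> kl; rewrite /Y (drop_nth false kl).
pose k0 : 'I_(size l) := Ordinal (etrans (index_mem true l) bl).
have k0P : nth false l k0 by rewrite /= nth_index.
(* [val x k] is the smallest value at x of a monotone degree one map sending [Y k.+1] to [Y k]. *)
pose val x (k : 'I_(size l)) := Y k + (Num.floor (x - Y k.+1))%:~R.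
pose K x := [arg max_(k > k0 | nth false l k) val x k]%O.
pose G x := val x (K x).
have GP x : nth false l (K x) /\ forall k : 'I_(size l), nth false l k -> val x k <= G x.
  by rewrite /G /K; case: arg_maxP.
have val1 x k : val (x + 1) k = val x k + 1.
  rewrite /val -[RHS]addrA; congr (_ + _).
  have -> : x + 1 - Y k.+1 = x - Y k.+1 + 1 by ring.
  by rewrite floorDrz ?intr1 // floor1 intrD.
have valm x x' k : x <= x' -> val x k <= val x' k.
  by move=> xx; rewrite lerD2l ler_int; apply: le_floor; rewrite lerD2r.
have dG : degree_one G.
  split=> [x x' xx|x].
    by apply: le_trans (valm _ _ _ xx) _; apply: (GP x').2; exact: (GP x).1.
  apply/eqP; rewrite eq_le; apply/andP; split.
    by rewrite {1}/G val1 lerD2r; apply: (GP x).2; exact: (GP _).1.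
  by rewrite -val1; apply: (GP _).2; exact: (GP _).1.
have Gg x : G x <= g x.
  rewrite /G /val Ystep // (GP x).1 -degree_oneDz; last exact: degree_one_lift.
  apply: (degree_one_lift g).1; rewrite -lerBrDl.
  by have := floor_itv (x - Y (K x).+1) => /andP[].
have YG k : (k < size l)%N -> nth false l k -> Y k <= G (Y k.+1).
  move=> kl lk; have := (GP (Y k.+1)).2 (Ordinal kl) lk.
  by rewrite /val subrr floor0 addr0.
have [|v [u [z [v0 vl per]]]] := @exists_periodic_point R _ (fun k : 'I_(size l) => Y k) G dG.
  by move=> x; exists (K x), (Num.floor (x - Y (K x).+1)).
have [L potL] := exists_potential_periodic v0 dG per.
exists u, v, (H \o Y), (L \o Y); rewrite card_ord in vl; split=> //.
  apply: (@rotnum_ge _ g v u z v0); rewrite -per.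
  elim: (v) => //= n IH; apply: le_trans (Gg _) _.
  exact: (degree_one_lift g).1.
have [Hm _ HF] := potH; have [Lm _ LG] := potL.
have end_le (P : R -> int) F' p' q' : potential F' p' q' P ->
    P (Y (size l)) + c * q'%:Z <= P (Y 0%N).
  move=> potP; rewrite -(potentialDz _ _ potP) Yend /Y drop0.
  by case: potP => Pm _ _; exact: Pm.
split=> /=.
- move=> k kl; have := Ystep k kl; case: ifP => [lk _|lk ->]; last exact: HF.
  by apply: le_trans (LG _); apply: Lm; exact: YG.
- move=> k j m _ _; rewrite -(potentialDz _ _ potH) -(potentialDz _ _ potL) => lt.
  apply: Lm; rewrite leNgt; apply/negP => /ltW /Hm.
  by rewrite leNgt lt.
- exact: end_le potH.
- exact: end_le potL.
Qed.

(* The sublevel sets of the potential of f are closed half-lines, because f is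
   continuous; F rounds f up to their endpoints. *)
Lemma exists_rounding f p q : (0 < q)%N -> rotnum f = p%:~R / q%:R ->
  exists F H (V : 'I_q -> R), [/\ degree_one F, forall x, f x <= F x,
    potential F p q H & forall x, exists i (m : int), F x = V i + m%:~R].
Proof.
move=> q0 rf; have [H potH HP] := exists_potential_lift q0 rf.
have q0' : 0 < q%:R :> R by rewrite ltr0n.
have [Hm H1 Hf] := potH.
pose A (j : int) := [set y | H y <= j]; pose X j := sup (A j).
have supA j : has_sup (A j).
  split.
    exists (0 + (- `|H 0 - j|)%:~R); rewrite /A /= (potentialDz _ _ potH).
    have : `|H 0 - j| * 1 <= `|H 0 - j| * q%:Z by rewrite ler_wpM2l // lez_nat.
    by have := ler_norm (H 0 - j); rewrite mulr1 mulNr; lra.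
  exists (j%:~R / q%:R) => y /HP /(_ 0%N).
  by rewrite mul0r addr0 /= ler_pdivlMr // mulrC.
(* The half-line contains its supremum: if some iterate of [X j] exceeded its bound t, the inverse
   iterate of t would lie strictly below [X j] and yet bound the half-line. *)
have HX j : H (X j) <= j.
  apply/HP => n; rewrite leNgt; apply/negP => lt.
  pose t : R := (j%:~R + n%:R * p%:~R) / q%:R.
  have dV := degree_one_iter n (degree_one_lift (f^-1)%g).
  have itK : cancel (iter n f) (iter n (f^-1)%g).
    elim: n {t lt dV} => [//|n IH] x.
    by rewrite iterSr [iter n.+1 f x]iterS (_ : _ (f _) = iter n f x) //; exact: lift_funK.
  have itVK : cancel (iter n (f^-1)%g) (iter n f).
    elim: n {t lt dV itK} => [//|n IH] x.
    rewrite iterSr [iter n.+1 _ x]iterS (_ : f _ = iter n (f^-1)%g x) //.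
    exact: lift_invK.
  have lt1 : iter n (f^-1)%g t < X j.
    rewrite ltNge; apply/negP => /(degree_one_iter n (degree_one_lift f)).1.
    by rewrite itVK ler_pdivlMr // mulrC leNgt lt.
  have [y yA ty] := sup_adherent (etrans (subr_gt0 _ _) lt1) (supA j).
  have : iter n f y <= t by rewrite ler_pdivlMr // mulrC; exact: (HP y j).1.
  by move/dV.1; rewrite itK; move: ty; rewrite -/(X j); lra.
(* [X] is the upper adjoint of [H], so X (H x + p) is the largest point of potential at most H x +
   p; in particular it is above f x. Since [H] gains q over a unit length, [X] has q values modulo
   1. *)
have galois y j : y <= X j <-> H y <= j.
  split=> [/Hm h|h]; first exact: le_trans h (HX j).
  by apply: sup_upper_bound.
have Xm j m : X (j + m * q%:Z) = X j + m%:~R.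
  apply/eqP; rewrite eq_le -lerBlDr; apply/andP; split; apply/galois.
    have := HX (j + m * q%:Z).
    by rewrite -{1}[X _](subrK (m%:~R)) (potentialDz _ _ potH) lerD2r.
  by rewrite (potentialDz _ _ potH) lerD2r.
have Xle i j : i <= j -> X i <= X j.
  by move=> ij; apply/galois; exact: le_trans (HX i) ij.
exists (fun x => X (H x + p)), H, (fun i => X i%:Z); split.
- split=> [x y xy|x]; first by apply: Xle; rewrite lerD2r; exact: Hm.
  by rewrite H1 addrAC -[q%:Z]mul1r Xm.
- by move=> x; apply/galois.
- by split=> // x; exact: HX.
- move=> x; have q0z : q%:Z != 0 by rewrite -lt0n in q0 *; case: (q) q0.
  set j := H x + p.
  have lt : (`|(j %% q%:Z)%Z| < q)%N.
    rewrite -ltz_nat gez0_abs ?modz_ge0 //; exact: ltz_pmod.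
  exists (Ordinal lt), (j %/ q%:Z)%Z; rewrite -Xm /= gez0_abs ?modz_ge0 //.
  by rewrite addrC -divz_eq.
Qed.

End Certificates.


(** * Homomorphisms of the free group with prescribed images of the generators *)

Section Representation.
Variable (G : groupType) (x y : G).
Local Open Scope group_scope.

Let letter_value (l : bool * bool) : G :=
  let z := if l.1 then y else x in if l.2 then z^-1 else z.

Definition free_eval (l : seq (bool * bool)) : G :=
  foldr (fun a z => letter_value a * z) 1 l.

Lemma free_eval_cat l l' : free_eval (l ++ l') = free_eval l * free_eval l'.
Proof. by elim: l => [|a l IH] /=; rewrite ?mul1g // IH mulgA. Qed.

Lemma free_eval_reduce l : free_eval (reduce l) = free_eval l.
Proof.
elim: l => //= a l <-; case: (reduce l) => [|a' l'] //=.
case: eqP => //= ->; rewrite /linv /letter_value /=.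
by case: a => [z []] /=; rewrite mulgA ?invgK ?mulVg ?mulgV mul1g.
Qed.

Definition free_hom (w : F2) : G := free_eval (val w).

Lemma free_homM : {morph free_hom : u v / u * v}.
Proof. by move=> u v; rewrite /free_hom /= free_eval_reduce free_eval_cat. Qed.

HB.instance Definition _ := isMultiplicative.Build F2 G free_hom free_homM.

Lemma free_hom_a : free_hom gen_a = x.
Proof. by rewrite /free_hom /= mulg1. Qed.

Lemma free_hom_b : free_hom gen_b = y.
Proof. by rewrite /free_hom /= mulg1. Qed.

End Representation.

(** * Rotation numbers of positive words and attainment of the supremum *)

Section Words.
Variable R : realType.
Implicit Types (f g h : homeo_lift R) (F G : R -> R) (x y r s t : R).
Implicit Types (w : F2) (l : seq bool).

Definition word_hom f g l : homeo_lift R :=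
  foldr (fun b z => (if b then g else f) * z)%g 1%g l.

Definition letters w : seq bool := map fst (val w).

Lemma occursE b w : occurs b w = (b \in letters w).
Proof.
by rewrite /occurs /letters; elim: (val w) => //= a v ->; rewrite inE eq_sym.
Qed.

Lemma word_homE f g l : word_hom f g l = word_act f g l :> (R -> R).
Proof. by apply: funext => y; elim: l => //= -[] l <-. Qed.

Lemma word_hom_cat f g l l' :
  word_hom f g (l ++ l') = (word_hom f g l * word_hom f g l')%g.
Proof. by elim: l => [|b l IH] /=; rewrite ?mul1g // IH mulgA. Qed.

Lemma positive_hom (rho : {multiplicative F2 -> homeo_lift R}) w : positive w ->
  rho w = word_hom (rho gen_a) (rho gen_b) (letters w).
Proof.
case: w => w; rewrite /positive /letters /=.
elim: w => [|a w IH] rw /=.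
  move=> _; have -> : exist _ [::] rw = 1%g :> F2 by exact: val_inj.
  by apply: (mulgI (rho 1%g)); rewrite -gmulfM !mulg1.
move=> /andP[a0 pw]; have rw' : reduced w := path_sorted rw.
rewrite -(IH rw' pw).
have -> : exist _ (a :: w) rw = (fgen a.1 * exist _ w rw')%g :> F2.
  apply: val_inj; case: a a0 {pw} rw => z [] //= _ rw.
  exact: esym (reduce_id (rw : reduced ((z, false) :: w))).
by rewrite gmulfM; case: (a.1).
Qed.

Lemma word_act_iter F G l d y :
  word_act F G (flatten (nseq d l)) y = iter d (word_act F G l) y.
Proof. by elim: d => //= d <-; rewrite /word_act foldr_cat. Qed.

Lemma degree_one_word_act F G l : degree_one F -> degree_one G ->
  degree_one (word_act F G l).
Proof.
by move=> dF dG; elim: l => [|[] l IH]; [split | exact: (degree_one_comp dG IH)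
  | exact: (degree_one_comp dF IH)].
Qed.

Lemma rotnum_mulC f g : rotnum (f * g)%g = rotnum (g * f)%g.
Proof. by rewrite -(rotnum_conj (g * f)%g g) mulgA mulVg mul1g. Qed.

Lemma rotnum_word_rot f g i l :
  rotnum (word_hom f g (rot i l)) = rotnum (word_hom f g l).
Proof.
by rewrite /rot word_hom_cat rotnum_mulC -word_hom_cat cat_take_drop.
Qed.

Lemma rotnum_le_disp f (B : R) : (forall x, f x <= x + B) -> rotnum f <= B.
Proof.
move=> fB; rewrite -subr_le0; apply: (@le0_archi _ _ 1) => n.
have : iter n f 0 <= n%:R * B.
  elim: n => [|n IH]; first by rewrite mul0r.
  by rewrite /= -natr1; apply: le_trans (fB _) _; lra.
by have := rotnum_orbit0 f n; rewrite ler_norml => /andP[? ?] ?; lra.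
Qed.

Lemma lift_le_disp f x : f x <= x + (rotnum f + 2).
Proof.
have := rotnum_orbit0 f 1; have := degree_one_disp x 0 (degree_one_lift f).
by rewrite /= !ler_norml => /andP[? ?] /andP[? ?]; lra.
Qed.

(** This crude bound serves twice: it makes the supremum in [maxrot] finite, and it bounds the
    certifiable integers u from below. *)
Lemma rotnum_word_le f g l :
  rotnum (word_hom f g l) <= (count_mem false l)%:R * (rotnum f + 2) +
                             (count_mem true l)%:R * (rotnum g + 2).
Proof.
apply: rotnum_le_disp => x; rewrite word_homE.
elim: l => [|[] l IH] /=; first by rewrite !mul0r !addr0.
  by rewrite add0n natrD; have := lift_le_disp g (word_act f g l x); lra.
by rewrite add0n natrD; have := lift_le_disp f (word_act f g l x); lra.
Qed.

Lemma exists_rotnum s : exists f, rotnum f = s.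
Proof.
have [|f [_ [_ rf _]]] := @exists_pushing_lift R (Num.floor s) 1 s isT; last by exists f.
by rewrite divr1 floor_le.
Qed.

Lemma maxrotE w r s : positive w -> maxrot w r s =
  sup [set rotnum (word_hom fg.1 fg.2 (letters w)) | fg in
        [set fg : homeo_lift R * homeo_lift R | rotnum fg.1 = r /\ rotnum fg.2 = s]].
Proof.
move=> pw; congr sup; apply/seteqP; split=> z [].
  move=> rho [ra rb] <-; exists (rho gen_a, rho gen_b) => //=.
  by rewrite -positive_hom.
move=> [f g] [/= rf rg] <-.
exists (free_hom f g : {multiplicative F2 -> homeo_lift R}) => /=.
  by rewrite free_hom_a free_hom_b.
by rewrite positive_hom //= free_hom_a free_hom_b.
Qed.

Lemma rotnum_le_maxrot w f g : positive w ->
  rotnum (word_hom f g (letters w)) <= maxrot w (rotnum f) (rotnum g).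
Proof.
move=> pw; rewrite maxrotE //; apply: sup_upper_bound; last by exists (f, g).
split; first by exists (rotnum (word_hom f g (letters w))), (f, g).
exists ((count_mem false (letters w))%:R * (rotnum f + 2) +
        (count_mem true (letters w))%:R * (rotnum g + 2)).
by move=> _ [[f' g'] [/= <- <-] <-]; exact: rotnum_word_le.
Qed.

Lemma maxrot_le w r s (B : R) : positive w ->
  (forall f g, rotnum f = r -> rotnum g = s ->
     rotnum (word_hom f g (letters w)) <= B) -> maxrot w r s <= B.
Proof.
move=> pw hB; rewrite maxrotE //; apply: ge_sup.
  have [f rf] := exists_rotnum r; have [g rg] := exists_rotnum s.
  by exists (rotnum (word_hom f g (letters w))), (f, g).
by move=> _ [[f g] [/= rf rg] <-]; exact: hB.
Qed.

(** Rounding f up can only increase the word, so a periodic point of the rounded word gives the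
    upper bound e/d; realizing the certificate of that periodic orbit gives the second pair. *)
Lemma rotnum_word_improve f g l p q : (0 < q)%N -> rotnum f = p%:~R / q%:R ->
  true \in l -> false \in l ->
  exists (e : int) (d : nat) f' g', [/\ (0 < d)%N, (d <= q)%N,
    rotnum (word_hom f g l) <= e%:~R / d%:R,
    rotnum f' = rotnum f /\ rotnum g' = rotnum g &
    e%:~R / d%:R <= rotnum (word_hom f' g' l)].
Proof.
move=> q0 rf bl al; have [F [H [V [dF fF potH FV]]]] := exists_rounding q0 rf.
(* In this conjugate word an a acts last, so all values are among the q values of [F] modulo 1. *)
pose l' := rot (index false l) l.
have dg := degree_one_lift g; have df := degree_one_lift f.
have [|d [e [z [d0 dq per]]]] := exists_periodic_point
    (V := V) (degree_one_word_act l' dF dg).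
  by move=> x; rewrite /l' /rot (drop_nth false) ?index_mem // nth_index //=.
have bl' : true \in flatten (nseq d l').
  apply/flattenP; exists l'; last by rewrite mem_rot.
  by rewrite mem_nseq d0 eqxx.
have [|u [v [Hl [Kl [v0 _ uv cert]]]]] :=
    exists_certificate (c := e) (g := g) (y := z) potH bl'.
  by rewrite word_act_iter per.
have [f' [g' [rf' rg' [y hy]]]] := certificate_realization q0 v0 uv cert.
exists e, d, f', g'; rewrite card_ord in dq; split=> //.
- rewrite -(rotnum_word_rot _ _ (index false l)) -/l'.
  apply: (rotnum_le (x := z) d0); rewrite -per word_homE.
  elim: (d) => //= n IH.
  have le1 x : word_act f g l' x <= word_act F g l' x.
    elim: (l') => //= -[] l'' IH'; first exact: dg.1.
    by apply: le_trans (fF _) _; exact: dF.1.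
  apply: le_trans (le1 _) _.
  exact: (degree_one_word_act l' dF dg).1.
- by rewrite rf rf'.
- rewrite -(rotnum_word_rot _ _ (index false l)) -/l'.
  by apply: (rotnum_ge (x := y) d0); rewrite word_homE -word_act_iter.
Qed.

Lemma rotnum_word_b f g l : false \notin l ->
  rotnum (word_hom f g l) = (size l)%:R * rotnum g.
Proof.
move=> al; apply: (@rotnum_unique _ _ 0 _ 1) => n.
suff -> : iter n (word_hom f g l) 0 = iter (n * size l) g 0.
  by rewrite mulrA -natrM; exact: rotnum_orbit0.
have act y : word_hom f g l y = iter (size l) g y.
  rewrite word_homE; elim: l al => //= -[] l IH //=.
  by rewrite inE => /IH ->.
by elim: n => //= n ->; rewrite act mulSn iterD.
Qed.

Lemma dvdn_coprime_cross (c e : int) (d d' : nat) : coprime `|c|%N d ->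
  e * d%:Z = c * d'%:Z -> (d %| d')%N.
Proof.
move=> cd /(congr1 absz); rewrite !abszM !absz_nat => E.
have : (d %| `|c| * d')%N by rewrite -E dvdn_mull.
by rewrite Gauss_dvdr // coprime_sym.
Qed.

Lemma maxrot_attained w p q c d t : positive w -> occurs true w ->
  (0 < q)%N -> (0 < d)%N -> coprime `|c|%N d ->
  maxrot w (p%:~R / q%:R) t = c%:~R / d%:R :> R ->
  (occurs false w -> (d <= q)%N) /\
  exists f g, [/\ rotnum f = p%:~R / q%:R, rotnum g = t &
    c%:~R / d%:R <= rotnum (word_hom f g (letters w))].
Proof.
move=> pw bw q0 d0 cd maxw.
rewrite occursE in bw; rewrite occursE.
have [al|al] := boolP (false \in letters w); last first.
  split=> //; have [f rf] := exists_rotnum (p%:~R / q%:R).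
  have [g rg] := exists_rotnum t; exists f, g; split=> //.
  rewrite -maxw; apply: maxrot_le => // f' g' _ rg'.
  by rewrite !rotnum_word_b // rg rg'.
have q0' : 0 < q%:R :> R by rewrite ltr0n.
have d0' : 0 < d%:R :> R by rewrite ltr0n.
have att : exists f g, [/\ rotnum f = p%:~R / q%:R, rotnum g = t &
    c%:~R / d%:R <= rotnum (word_hom f g (letters w))].
  apply: contrapT => nP.
  (* A fraction e/d' < c/d with d' <= q misses c/d by at least 1/(d d') >= 1/(d q). If no pair
     reached c/d, this gap would separate the supremum from c/d. *)
  suff : maxrot w (p%:~R / q%:R) t <= c%:~R / d%:R - (d%:R * q%:R)^-1.
    have : 0 < (d%:R * q%:R)^-1 :> R by rewrite invr_gt0 mulr_gt0.
    by rewrite maxw; lra.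
  apply: maxrot_le => // f g rf rg.
  have [e [d' [f' [g' [d0'' dq le1 [rf' rg'] le2]]]]] :=
    rotnum_word_improve g q0 rf bw al.
  have lt : rotnum (word_hom f' g' (letters w)) < c%:~R / d%:R.
    by rewrite ltNge; apply/negP => le3; apply: nP; exists f', g'; rewrite rf' rg'.
  apply: le_trans le1 _; have := le_lt_trans le2 lt.
  have d1 : 0 < d'%:R :> R by rewrite ltr0n.
  rewrite ltr_pdivrMr // mulrAC ltr_pdivlMr //.
  have -> : e%:~R * d%:R = (e * d%:Z)%:~R :> R by rewrite intrM.
  have -> : c%:~R * d'%:R = (c * d'%:Z)%:~R :> R by rewrite intrM.
  rewrite ltr_int -lezD1 -(ler_int R) intrD !intrM /= -!pmulrn => le3.
  have dq' : d'%:R <= q%:R :> R by rewrite ler_nat.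
  apply: (@le_trans _ _ (c%:~R / d%:R - (d%:R * d'%:R)^-1)).
    have -> : c%:~R / d%:R - (d%:R * d'%:R)^-1 = (c%:~R * d'%:R - 1) / d%:R / d'%:R :> R.
      by field; apply/andP; split; lra.
    by rewrite ler_pM2r ?invr_gt0 // ler_pdivlMr //; lra.
  by rewrite lerD2l lerN2 lef_pV2 ?posrE ?mulr_gt0 // ler_pM2l.
(* For a pair that reaches c/d, the fraction e/d' is squeezed onto c/d, so d divides d' <= q. *)
split=> // _; have [f [g [rf rg le0]]] := att.
have [e [d' [f' [g' [d0'' dq le1 [rf' rg'] le2]]]]] :=
  rotnum_word_improve g q0 rf bw al.
apply: leq_trans dq; apply: dvdn_leq => //.
have d1 : 0 < d'%:R :> R by rewrite ltr0n.
apply: (@dvdn_coprime_cross c e) => //; apply/eqP; rewrite -(eqr_int R) !intrM.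
rewrite -eqr_div ?lt0r_neq0 // eq_le (le_trans le0 le1) andbT.
apply: le_trans le2 _; rewrite -maxw -rf -rg -rf' -rg'.
exact: rotnum_le_maxrot.
Qed.

End Words.


(** * Certifiable integers and the infimum of a level set *)

Section Infimum.
Variable R : realType.
Implicit Types (f g h : homeo_lift R) (r s t : R) (w : F2) (l : seq bool).

Definition certifiable l p q c d D (u : int) := exists Hl Kl,
  certificate (flatten (nseq d l)) p q u D c Hl Kl.

Lemma certifiable_le l p q c d D u u' : u <= u' ->
  certifiable l p q c d D u -> certifiable l p q c d D u'.
Proof.
move=> uu [Hl [Kl [step mono Hend Kend]]]; exists Hl, Kl; split=> // k kl.
have := step k kl; case: ifP => // _ h.
by apply: le_trans h _; rewrite lerD2l.
Qed.

(** Every condition is either free of K, u and v, or has a conclusion homogeneous in them. This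
    brings all certificates to a common denominator. *)
Lemma certificate_scale l p q u v c Hl Kl (e : nat) :
  (0 < e)%N -> certificate l p q u v c Hl Kl ->
  certificate l p q (u * e%:Z) (v * e) c Hl (fun k => Kl k * e%:Z).
Proof.
move=> e0 [step mono Hend Kend]; split=> //.
- move=> k kl; have := step k kl; case: ifP => // _ h.
  by rewrite -mulrDl ler_wpM2r.
- move=> k j m kl jl /(mono k j m kl jl) h.
  by rewrite PoszM mulrA -mulrDl ler_wpM2r.
- by rewrite PoszM mulrA -mulrDl ler_wpM2r.
Qed.

Lemma flatten_nseq_size (T : Type) d (l : seq T) :
  size (flatten (nseq d l)) = (d * size l)%N.
Proof. by rewrite size_flatten /shape map_nseq sumn_nseq mulnC. Qed.

Lemma exists_certifiable l p q c d D f g : (0 < q)%N -> (0 < d)%N ->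
  true \in l -> (0 < D)%N ->
  (forall v, (0 < v <= d * size l)%N -> (v %| D)%N) ->
  rotnum f = p%:~R / q%:R -> c%:~R / d%:R <= rotnum (word_hom f g l) ->
  exists2 u, u%:~R / D%:R <= rotnum g & certifiable l p q c d D u.
Proof.
move=> q0 d0 bl D0 hD rf le0.
have [H potH _] := exists_potential_lift q0 rf.
have [y hy] := rotnum_ge_point d0 le0.
have bl' : true \in flatten (nseq d l).
  by apply/flattenP; exists l => //; rewrite mem_nseq d0 eqxx.
have [|u [v [Hl [Kl [v0 vl uv cert]]]]] :=
    exists_certificate (c := c) (g := g) (y := y) potH bl'.
  by rewrite word_act_iter -word_homE.
have vD : (v %| D)%N by apply: hD; rewrite v0 -flatten_nseq_size.
have eD : (v * (D %/ v))%N = D by rewrite mulnC divnK.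
have e0 : (0 < D %/ v)%N by rewrite divn_gt0 // dvdn_leq.
exists (u * (D %/ v)%:Z); last first.
  by exists Hl; eexists; rewrite -{2}eD; exact: certificate_scale cert.
apply: le_trans uv; rewrite le_eqVlt; apply/orP; left.
have v0' : v%:R != 0 :> R by rewrite pnatr_eq0 -lt0n.
have D0' : D%:R != 0 :> R by rewrite pnatr_eq0 -lt0n.
by rewrite eqr_div // intrM /= -pmulrn -mulrA -natrM mulnC eD.
Qed.

Lemma certifiable_maxrot w p q c d D u s : positive w -> (0 < q)%N ->
  (0 < d)%N -> (0 < D)%N -> certifiable (letters w) p q c d D u ->
  u%:~R / D%:R <= s -> c%:~R / d%:R <= maxrot w (p%:~R / q%:R) s.
Proof.
move=> pw q0 d0 D0 [Hl [Kl cert]] us.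
have [f [g [rf rg [y hy]]]] := certificate_realization q0 D0 us cert.
rewrite -rf -rg; apply: le_trans (rotnum_le_maxrot _ _ pw).
by apply: (rotnum_ge (x := y) d0); rewrite word_homE -word_act_iter.
Qed.

(** A word value at s above R(w, p/q, t) would leave a rational strictly between them; the
    certificate it yields at s is also realized with rotation number t. *)
Lemma maxrot_le_mono w p q s t : positive w -> occurs true w -> (0 < q)%N ->
  s <= t -> maxrot w (p%:~R / q%:R) s <= maxrot w (p%:~R / q%:R) t.
Proof.
move=> pw bw q0 st; apply: maxrot_le => // f g rf rg.
rewrite leNgt; apply/negP => lt.
have [x] := rat_in_itvoo lt; rewrite in_itv /= => /andP[x1 x2].
have xE : ratr x = (numq x)%:~R / `|denq x|%N%:R :> R.
  by rewrite /ratr pmulrn absz_denq.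
rewrite xE in x1 x2.
have d0 : (0 < `|denq x|)%N by rewrite absz_gt0 gt_eqF.
rewrite occursE in bw.
have [u us cu] := exists_certifiable q0 d0 bw (fact_gt0 _)
  (fun v => @dvdn_fact v _) rf (ltW x2).
rewrite rg in us.
by move: x1; rewrite ltNge (certifiable_maxrot pw q0 d0 _ cu (le_trans us st)) // fact_gt0.
Qed.

(** Each point of the level set lies above u/D for some certifiable u, and certifiability of u gives
    R >= c/d at u/D; monotonicity turns this into equality at the least u. The second part covers
    every u on the boundary of certifiability, because such a u is what the search tests for. *)
Lemma maxrot_level w p q c d D : positive w -> occurs true w -> (0 < q)%N ->
  (0 < d)%N -> coprime `|c|%N d -> (0 < D)%N ->
  (forall v, (0 < v <= d * size (letters w))%N -> (v %| D)%N) ->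
  let C := certifiable (letters w) p q c d D in
  let S := [set t : R | maxrot w (p%:~R / q%:R) t = c%:~R / d%:R] in
  S !=set0 ->
  (exists u, C u /\ ~ C (u - 1)) /\
  forall u, C u -> ~ C (u - 1) -> [/\ has_inf S, inf S = u%:~R / D%:R &
    maxrot w (p%:~R / q%:R) (u%:~R / D%:R) = c%:~R / d%:R :> R].
Proof.
move=> pw bw q0 d0 cd D0 hD C S S0.
have bl : true \in letters w by rewrite -occursE.
have D0' : 0 < D%:R :> R by rewrite ltr0n.
have SC t : S t -> exists2 u, u%:~R / D%:R <= t & C u.
  move=> St; have [_ [f [g [rf rg le0]]]] := maxrot_attained pw bw q0 d0 cd St.
  by rewrite -rg; exact: (exists_certifiable q0 d0 bl D0 hD rf le0).
split.
  have [t /SC [u1 _ Cu1]] := S0.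
  pose a : R := (count_mem false (letters w))%:R * (p%:~R / q%:R + 2).
  pose b : R := (count_mem true (letters w))%:R.
  (* As the letter b occurs, a very negative u/D would keep the word below c/d; this bounds the
     certifiable u from below. *)
  have b0 : 0 < b by rewrite ltr0n -has_count has_pred1.
  have lowC u : C u -> ((c%:~R / d%:R - a) / b - 2) * D%:R <= u%:~R.
    move=> [Hl [Kl cert]].
    have [f [g [rf rg [y hy]]]] := certificate_realization q0 D0 (lexx (u%:~R / D%:R : R)) cert.
    have le1 : c%:~R / d%:R <= rotnum (word_hom f g (letters w)).
      by apply: (rotnum_ge (x := y) d0); rewrite word_homE -word_act_iter.
    rewrite -ler_pdivlMr // lerBlDr ler_pdivrMr // [leRHS]mulrC lerBlDl -rg /a -rf.
    exact: le_trans le1 (rotnum_word_le _ _ _).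
  apply: contrapT => nP.
  have all n : C (u1 - Posz n).
    elim: n => [|n IH]; first by rewrite subr0.
    apply: contrapT => nC; apply: nP; exists (u1 - Posz n); split=> //.
    by rewrite -addrA -opprD -PoszD addn1.
  pose B := ((c%:~R / d%:R - a) / b - 2) * D%:R.
  have := lowC _ (all (Num.bound `|u1%:~R - B|)).
  rewrite intrB -/B -pmulrn; have := archi_boundP (normr_ge0 (u1%:~R - B)).
  by have := ler_norm (u1%:~R - B); lra.
move=> u Cu nCu.
have lbS : lbound S (u%:~R / D%:R).
  move=> t /SC [u' le' Cu']; apply: le_trans le'.
  rewrite ler_pM2r ?invr_gt0 // ler_int leNgt; apply/negP => lt.
  by apply: nCu; apply: certifiable_le Cu'; lia.
have Su : maxrot w (p%:~R / q%:R) (u%:~R / D%:R) = c%:~R / d%:R :> R.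
  apply/eqP; rewrite eq_le (certifiable_maxrot pw q0 d0 D0 Cu (lexx _)) andbT.
  have [t St] := S0; rewrite -[X in _ <= X]St.
  by apply: maxrot_le_mono => //; exact: lbS.
have hS : has_inf S by split=> //; exists (u%:~R / D%:R).
split=> //; apply/eqP; rewrite eq_le; apply/andP; split.
  by apply: inf_lbound => //; exact: hS.2.
exact: lb_le_inf.
Qed.

End Infimum.


(** * Closure properties of recursive functions and decoding of sequences *)

Section Computability.
Local Open Scope nat_scope.
Implicit Types (k m n : nat) (xs ys : seq nat).

(** The length is fixed so that a substitution can rebuild the argument list from k projections. *)
Definition computable k (f : seq nat -> nat) :=
  exists e, forall xs, size xs = k -> computes e xs (f xs).

Definition decidable_pred k (P : seq nat -> bool) :=
  computable k (fun xs => P xs : nat).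

Lemma computable_ext k f g : (forall xs, size xs = k -> f xs = g xs) ->
  computable k f -> computable k g.
Proof. by move=> fg [e he]; exists e => xs xk; rewrite -fg //; exact: he. Qed.

(** Bound variables are pushed in front of the arguments, so the outer ones are read below several
    [behead]s. *)
Lemma computable_nth k m i : computable k (fun xs => nth 0 (iter m behead xs) i).
Proof.
exists (MProj (m + i)) => xs _.
suff -> : nth 0 (iter m behead xs) i = nth 0 xs (m + i) by exact: computes_proj.
by elim: m i => //= m IH i; rewrite nth_behead IH addnS.
Qed.

Lemma computable_var k i : computable k (fun xs => nth 0 xs i).
Proof. exact: (computable_nth k 0). Qed.

Lemma computable_comp k f (gs : seq (seq nat -> nat)) : computable (size gs) f ->
  (forall i, i < size gs -> computable k (nth (fun=> 0) gs i)) ->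
  computable k (fun xs => f [seq g xs | g <- gs]).
Proof.
move=> [e he] hgs.
have [es hes] : exists es, forall xs, size xs = k ->
    computes_all es xs [seq g xs | g <- gs].
  elim: gs hgs {e he} => [|g gs IH] hgs.
    by exists [::] => xs _; exact: computes_nil.
  have [es hes] := IH (fun i => hgs i.+1); have [e he] := hgs 0 isT.
  by exists (e :: es) => xs xk; apply: computes_cons; [exact: he | exact: hes].
exists (MComp e es) => xs xk; apply: computes_comp (hes _ xk) _.
by apply: he; rewrite size_map.
Qed.

Lemma computable_let k f g : computable k.+1 f -> computable k g ->
  computable k (fun xs => f (g xs :: xs)).
Proof.
move=> cf cg; pose gs := g :: [seq (fun xs => nth 0 xs i) | i <- iota 0 k].
have sgs : size gs = k.+1 by rewrite /= size_map size_iota.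
have := @computable_comp k f gs; rewrite sgs => /(_ cf) h.
apply: computable_ext (h _) => [xs xk|[|i] ik] //=.
  by congr (f (_ :: _)); rewrite -map_comp -[RHS](mkseq_nth 0 xs) xk.
rewrite /gs /= (nth_map 0) ?size_iota //; exact: computable_var.
Qed.

Lemma computable1 k F f : computable 1 (fun xs => F (nth 0 xs 0)) ->
  computable k f -> computable k (fun xs => F (f xs)).
Proof. by move=> cF cf; apply: (computable_comp (gs := [:: f]) cF) => -[]. Qed.

Lemma computable2 k F f g : computable 2 (fun xs => F (nth 0 xs 0) (nth 0 xs 1)) ->
  computable k f -> computable k g -> computable k (fun xs => F (f xs) (g xs)).
Proof.
by move=> cF cf cg; apply: (computable_comp (gs := [:: f; g]) cF) => -[|[]].
Qed.

Lemma computable_succ k f : computable k f -> computable k (fun xs => (f xs).+1).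
Proof. by apply: computable1; exists MSucc => xs _; exact: computes_succ. Qed.

Lemma computable_const k n : computable k (fun=> n).
Proof.
elim: n => [|n IH]; last exact: computable_succ.
by exists MZero => xs _; exact: computes_zero.
Qed.

Lemma computable_rec k (n f : seq nat -> nat) g : computable k n -> computable k f ->
  computable k.+2 (fun xs => g (nth 0 xs 0) (nth 0 xs 1) (behead (behead xs))) ->
  computable k (fun xs => nat_rect (fun=> nat) (f xs) (fun i r => g i r xs) (n xs)).
Proof.
move=> cn [e he] [e' he'].
pose h xs := nat_rect (fun=> nat) (f (behead xs)) (fun i r => g i r (behead xs))
  (nth 0 xs 0).
apply: (@computable_let k h n) => //; exists (MRec e e') => -[//|m xs] [xk].
rewrite /h /=; elim: m => [|m IH] /=; first by apply: computes_rec0; exact: he.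
apply: computes_recS IH _; apply: (he' [:: _, _ & xs]).
by rewrite /= xk.
Qed.

Lemma computable_iter k (n f : seq nat -> nat) F : computable 1 (fun xs => F (nth 0 xs 0)) ->
  computable k n -> computable k f -> computable k (fun xs => iter (n xs) F (f xs)).
Proof.
move=> cF cn cf.
apply: (computable_rec (g := fun _ r _ => F r)) => //.
by apply: computable1 => //; exact: computable_var.
Qed.

Lemma computable_add k f g : computable k f -> computable k g ->
  computable k (fun xs => f xs + g xs).
Proof.
apply: computable2; have c := computable_var 2.
apply: computable_ext (computable_rec (g := fun _ r _ => r.+1) (c 0) (c 1) _).
  by move=> xs _; elim: (nth 0 xs 0) => //= n ->.
by apply: computable_succ; exact: computable_var.
Qed.

Lemma computable_mul k f g : computable k f -> computable k g ->
  computable k (fun xs => f xs * g xs).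
Proof.
apply: computable2; have c := computable_var 2.
apply: computable_ext (computable_rec (g := fun _ r xs => nth 0 xs 1 + r)
  (c 0) (computable_const 2 0) _).
  by move=> xs _; elim: (nth 0 xs 0) => //= n ->.
by apply: computable_add; [exact: (computable_nth _ 2) | exact: computable_var].
Qed.

Lemma computable_pred k f : computable k f -> computable k (fun xs => (f xs).-1).
Proof.
apply: computable1; have c := computable_var 1.
apply: computable_ext (computable_rec (g := fun i _ _ => i) (c 0)
  (computable_const 1 0) _); last exact: computable_var.
by move=> xs _; case: (nth 0 xs 0).
Qed.

Lemma computable_sub k f g : computable k f -> computable k g ->
  computable k (fun xs => f xs - g xs).
Proof.
move=> cf cg; apply: (computable2 (F := subn)) cf cg; have c := computable_var 2.
apply: computable_ext (computable_iter (F := predn) _ (c 1) (c 0)).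
  by move=> xs _; rewrite iter_predn.
by apply: computable_pred; exact: computable_var.
Qed.

Lemma computable_exp k f g : computable k f -> computable k g ->
  computable k (fun xs => f xs ^ g xs).
Proof.
apply: computable2; have c := computable_var 2.
apply: computable_ext (computable_rec (g := fun _ r xs => nth 0 xs 0 * r)
  (c 1) (computable_const 2 1) _).
  by move=> xs _; elim: (nth 0 xs 1) => //= n ->; rewrite expnS.
by apply: computable_mul; [exact: (computable_nth _ 2) | exact: computable_var].
Qed.

Lemma computable_fact k f : computable k f -> computable k (fun xs => (f xs)`!).
Proof.
apply: computable1; have c := computable_var 1.
apply: computable_ext (computable_rec (g := fun i r _ => i.+1 * r) (c 0)
  (computable_const 1 1) _).
  by move=> xs _; elim: (nth 0 xs 0) => //= n ->; rewrite factS.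
by apply: computable_mul; [apply: computable_succ|]; exact: computable_var.
Qed.

Lemma computable_sum k (n : seq nat -> nat) g : computable k n ->
  computable k.+1 (fun xs => g (nth 0 xs 0) (behead xs)) ->
  computable k (fun xs => \sum_(0 <= i < n xs) g i xs).
Proof.
move=> cn cg.
apply: computable_ext (computable_rec (g := fun i r xs => r + g i xs) cn
  (computable_const k 0) _).
  move=> xs _; elim: (n xs) => [|m IH] /=; first by rewrite big_geq.
  by rewrite big_nat_recr //= IH.
apply: computable_add; first exact: computable_var.
(* The accumulator sits at position 1 and is skipped. *)
pose gs := [seq (fun xs => nth 0 xs (if i is 0 then 0 else i.+1)) | i <- iota 0 k.+1].
have sgs : size gs = k.+1 by rewrite size_map size_iota.
have := @computable_comp k.+2 _ gs; rewrite sgs => /(_ _ cg) h.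
apply: computable_ext (h _) => [[|a [|b xs]] // [xk]|i ik].
  rewrite /gs -map_comp /= -[X in g _ X = _]/(map _ _).
  rewrite (iotaDl 1 0) -map_comp -[in RHS](mkseq_nth 0 xs) xk.
  by congr (g _ _).
rewrite /gs (nth_map 0) ?size_iota //; exact: computable_var.
Qed.

Lemma decidable_neg k P : decidable_pred k P -> decidable_pred k (fun xs => ~~ P xs).
Proof.
move=> cP; apply: computable_ext (computable_sub (computable_const k 1) cP).
by move=> xs _; case: (P xs).
Qed.

Lemma decidable_and k P Q : decidable_pred k P -> decidable_pred k Q ->
  decidable_pred k (fun xs => P xs && Q xs).
Proof.
move=> cP cQ; apply: computable_ext (computable_mul cP cQ).
by move=> xs _; rewrite mulnb.
Qed.

Lemma decidable_imply k P Q : decidable_pred k P -> decidable_pred k Q ->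
  decidable_pred k (fun xs => P xs ==> Q xs).
Proof.
move=> cP cQ; apply: computable_ext (decidable_neg (decidable_and cP (decidable_neg cQ))).
by move=> xs _; case: (P xs) (Q xs) => [] [].
Qed.

Lemma decidable_eq0 k f : computable k f -> decidable_pred k (fun xs => f xs == 0).
Proof.
move=> cf; apply: computable_ext (computable_sub (computable_const k 1) cf).
by move=> xs _; case: (f xs) => [|[|]].
Qed.

Lemma decidable_leq k f g : computable k f -> computable k g ->
  decidable_pred k (fun xs => f xs <= g xs).
Proof. by move=> cf cg; apply: decidable_eq0; exact: computable_sub. Qed.

Lemma decidable_eq k f g : computable k f -> computable k g ->
  decidable_pred k (fun xs => f xs == g xs).
Proof.
move=> cf cg; apply: computable_ext (decidable_and (decidable_leq cf cg) (decidable_leq cg cf)).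
by move=> xs _; rewrite -eqn_leq.
Qed.

Lemma computable_if k P f g : decidable_pred k P -> computable k f ->
  computable k g -> computable k (fun xs => if P xs then f xs else g xs).
Proof.
move=> cP cf cg; apply: computable_ext
  (computable_add (computable_mul cP cf) (computable_mul (decidable_neg cP) cg)).
by move=> xs _; case: (P xs); rewrite !(mul1n, mul0n, addn0).
Qed.

Lemma decidable_all k (n : seq nat -> nat) P : computable k n ->
  decidable_pred k.+1 (fun xs => P (nth 0 xs 0) (behead xs)) ->
  decidable_pred k (fun xs => all (fun i => P i xs) (iota 0 (n xs))).
Proof.
move=> cn cP; apply: computable_ext (decidable_eq0 (computable_sum
  (g := fun i xs => ~~ P i xs) cn (decidable_neg cP))).
move=> xs _; congr nat_of_bool; rewrite /index_iota subn0.
elim: (iota 0 (n xs)) => [|i s IH] /=; first by rewrite big_nil.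
by rewrite big_cons addn_eq0 IH; case: (P i xs).
Qed.

Lemma decidable_has k (n : seq nat -> nat) P : computable k n ->
  decidable_pred k.+1 (fun xs => P (nth 0 xs 0) (behead xs)) ->
  decidable_pred k (fun xs => has (fun i => P i xs) (iota 0 (n xs))).
Proof.
move=> cn cP; apply: computable_ext (decidable_neg (decidable_all
  (P := fun i xs => ~~ P i xs) cn (decidable_neg cP))).
by move=> xs _; rewrite -has_predC; congr nat_of_bool; apply: eq_has => i /=; rewrite negbK.
Qed.

(** Quotients and lengths of codes are computed as bounded counts; this evaluates such a count. *)
Lemma sum_ltn m n : n <= m -> \sum_(0 <= i < m) (i < n) = n.
Proof.
elim: m => [|m IH]; first by rewrite leqn0 => /eqP ->; rewrite big_geq.
rewrite big_nat_recr //= leq_eqVlt => /orP[/eqP ->|]; last first.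
  by rewrite ltnS => nm; rewrite IH // ltnNge nm addn0.
rewrite ltnSn (eq_big_nat _ _ (F2 := fun=> 1)) ?sum_nat_const_nat ?muln1 ?subn0 ?addn1 //.
by move=> i /andP[_ im]; rewrite ltnS ltnW.
Qed.

Lemma computable_div k f g : computable k f -> computable k g ->
  computable k (fun xs => f xs %/ g xs).
Proof.
move=> cf cg; apply: (computable2 (F := divn)) cf cg; have c := computable_var 2.
apply: computable_ext (computable_if (decidable_eq0 (c 1)) (computable_const 2 0)
  (computable_sum (g := fun i xs => i.+1 * nth 0 xs 1 <= nth 0 xs 0) (c 0) _)).
  move=> xs _; case: eqP => [->|/eqP]; rewrite ?divn0 // -lt0n => d0.
  rewrite -[RHS](sum_ltn (leq_div _ _)); apply: eq_bigr => i _.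
  by rewrite leq_divRL.
apply: decidable_leq; last exact: (computable_nth _ 1).
apply: computable_mul; last exact: (computable_nth _ 1).
by apply: computable_succ; exact: computable_var.
Qed.

Lemma computable_mod k f g : computable k f -> computable k g ->
  computable k (fun xs => f xs %% g xs).
Proof.
move=> cf cg; apply: computable_ext
  (computable_sub cf (computable_mul (computable_div cf cg) cg)).
by move=> xs _; rewrite {1}(divn_eq (f xs) (g xs)) addKn.
Qed.

Lemma computable_half k f : computable k f -> computable k (fun xs => (f xs)./2).
Proof.
move=> cf; apply: computable_ext (computable_div cf (computable_const k 2)).
by move=> xs _; rewrite divn2.
Qed.

Lemma decidable_odd k f : computable k f -> decidable_pred k (fun xs => odd (f xs)).
Proof.
move=> cf; apply: computable_ext (computable_mod cf (computable_const k 2)).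
by move=> xs _; rewrite modn2.
Qed.

Lemma computable_logn2 k f : computable k f -> computable k (fun xs => logn 2 (f xs)).
Proof.
apply: computable1; have c := computable_var 1.
apply: computable_ext (computable_sum
  (g := fun i xs => nth 0 xs 0 %% 2 ^ i.+1 == 0) (computable_pred (c 0)) _).
  by move=> xs _; rewrite logn_count_dvd // big_add1.
apply: decidable_eq0; apply: computable_mod; first exact: (computable_nth _ 1).
apply: computable_exp; first exact: computable_const.
by apply: computable_succ; exact: computable_var.
Qed.

(** The code of n :: s is 2^n (2 c + 1) with c the code of s: its 2-adic valuation is the head, and
    half of its odd part, rounded down, is the code of the tail. *)
Definition code_tail c := (c %/ 2 ^ logn 2 c)./2.
Definition code_nth c i := logn 2 (iter i code_tail c).
(** Only the empty sequence has code 0, and a code is at least the length, so c iterations are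
    enough to count the nonempty suffixes. *)
Definition code_size c := \sum_(0 <= i < c) (iter i code_tail c != 0).

Lemma code_gt0 n s : 0 < CodeSeq.code (n :: s).
Proof. by rewrite /= muln_gt0 expn_gt0. Qed.

Lemma logn2_code n s : logn 2 (CodeSeq.code (n :: s)) = n.
Proof.
rewrite /= lognM ?expn_gt0 // pfactorK // lognE /= dvdn2 /= odd_double.
by rewrite addn0.
Qed.

Lemma code_tailE n s : code_tail (CodeSeq.code (n :: s)) = CodeSeq.code s.
Proof.
by rewrite /code_tail logn2_code [CodeSeq.code _]/= mulKn ?expn_gt0 // (half_bit_double _ true).
Qed.

Lemma iter_code_tail s i : iter i code_tail (CodeSeq.code s) = CodeSeq.code (drop i s).
Proof.
elim: i s => [|i IH] s; first by rewrite drop0.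
rewrite iterSr; case: s => [|n s]; last by rewrite code_tailE IH.
exact: (IH [::]).
Qed.

Lemma code_nthE s i : code_nth (CodeSeq.code s) i = nth 0 s i.
Proof.
rewrite /code_nth iter_code_tail.
have [si|si] := leqP (size s) i; first by rewrite drop_oversize // nth_default.
by rewrite (drop_nth 0 si) logn2_code.
Qed.

Lemma code_size_le s : size s <= CodeSeq.code s.
Proof.
elim: s => //= n s IH; rewrite -[(size s).+1]mul1n leq_mul ?expn_gt0 //.
by rewrite ltnS -addnn (leq_trans IH) // leq_addr.
Qed.

Lemma code_sizeE s : code_size (CodeSeq.code s) = size s.
Proof.
rewrite -[RHS](sum_ltn (code_size_le s)); apply: eq_bigr => i _.
rewrite iter_code_tail; have [si|si] := leqP (size s) i.
  by rewrite drop_oversize.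
by rewrite (drop_nth 0 si) -lt0n code_gt0.
Qed.

Lemma code_nth_le c i : code_nth c i <= c.
Proof.
rewrite -[c in code_nth c]CodeSeq.decodeK code_nthE -{2}[c]CodeSeq.decodeK.
have [si|si] := leqP (size (CodeSeq.decode c)) i; first by rewrite nth_default.
by have /allP/(_ _ (mem_nth 0 si))/ltnW := CodeSeq.ltn_code (CodeSeq.decode c).
Qed.

(** An entry n <= m costs a factor of at most 2^(m+1). Hence sequences with bounded entries can be
    found by a bounded search over codes. *)
Lemma code_bound m s : all (fun n => n <= m) s ->
  CodeSeq.code s < 2 ^ (m.+1 * size s).
Proof.
elim: s => [|n s IH] /=; first by rewrite muln0.
move=> /andP[nm /IH lt]; rewrite [m.+1 * _]mulnS expnD -mul2n.
have le1 : 2 ^ n <= 2 ^ m by rewrite leq_exp2l.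
have pos : 0 < 2 ^ m by rewrite expn_gt0.
rewrite expnS; nia.
Qed.

Lemma computable_tail k f : computable k f -> computable k (fun xs => code_tail (f xs)).
Proof.
move=> cf; apply: computable_half; apply: computable_div => //.
by apply: computable_exp; [exact: computable_const | exact: computable_logn2].
Qed.

Lemma computable_code_nth k f g : computable k f -> computable k g ->
  computable k (fun xs => code_nth (f xs) (g xs)).
Proof.
move=> cf cg; apply: computable_logn2; apply: computable_iter => //.
by apply: computable_tail; exact: computable_var.
Qed.

Lemma computable_code_size k f : computable k f ->
  computable k (fun xs => code_size (f xs)).
Proof.
apply: computable1; have c := computable_var 1.
apply: (computable_sum (g := fun i xs => iter i code_tail (nth 0 xs 0) != 0)) => //.
apply: decidable_neg; apply: decidable_eq0; apply: computable_iter.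
- by apply: computable_tail; exact: computable_var.
- exact: computable_var.
- exact: (computable_nth _ 1).
Qed.

End Computability.


(** * An explicit bound on the size of certificates *)

Section BoundedCertificates.
Implicit Types (l : seq bool) (p u c : int) (q v : nat) (H K : nat -> int).

(** Strictness of the result matters: the order condition turns a strict bound on H into a bound on
    K, and by contraposition a strict bound on K into a bound on H. *)
Lemma certificate_step p q (T x y z lam : int) :
  (0 < q)%N -> `|p| < T -> z <= y + p -> y <= x + lam * q%:Z ->
  z < x + (lam + T) * q%:Z.
Proof.
move=> q0 pT zy yx; apply: le_lt_trans zy _.
have : p < T * q%:Z.
  apply: lt_le_trans (_ : T <= _); first exact: le_lt_trans (ler_norm p) pT.
  by rewrite -[leLHS]mulr1 ler_wpM2l // ltW // (le_lt_trans _ pT).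
by rewrite mulrDl addrA => ?; exact: ler_ltD.
Qed.

(** A letter controls only one of H and K; the order condition carries the bound over to the other.
    Upper bounds propagate backwards from the last index, lower bounds forwards from index 0, where
    the closing inequalities with c start the induction. *)
Lemma certificate_bound l p q u v c H K (T e : int) : (0 < q)%N -> (0 < v)%N ->
  `|p| < T -> `|u| < T -> `|c| <= e -> certificate l p q u v c H K ->
  let N := size l in
  forall k, (k <= N)%N ->
    [/\ H k <= H N + (N%:Z * T) * q%:Z, H N <= H k + (e + N%:Z * T) * q%:Z,
        K k <= K N + (N%:Z * T) * v%:Z & K N <= K k + (e + N%:Z * T) * v%:Z].
Proof.
move=> q0 v0 pT uT ce [step mono Hend Kend] N; rewrite -/N in step mono Hend Kend.
have T0 : 0 < T by exact: le_lt_trans (normr_ge0 p) pT.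
have up j : (j <= N)%N -> H (N - j)%N <= H N + (j%:Z * T) * q%:Z /\
                          K (N - j)%N <= K N + (j%:Z * T) * v%:Z.
  elim: j => [|j IH] jN; first by rewrite subn0 !mul0r !addr0.
  have [IH1 IH2] := IH (ltnW jN).
  have lt : (N - j.+1 < N)%N by rewrite ltn_subrL (leq_trans _ jN).
  have eS : (N - j.+1).+1 = (N - j)%N by rewrite subnSK.
  have eT : (j.+1%:Z * T) = j%:Z * T + T by rewrite -addn1 PoszD mulrDl mul1r.
  have := step _ lt; rewrite eS eT; case: ifP => _ h.
    have ltK := certificate_step v0 uT h IH2; split; last exact: ltW.
    rewrite leNgt; apply/negP => ltH.
    have : K N <= K (N - j.+1)%N + - (j%:Z * T + T) * v%:Z.
      by apply: mono => //; [exact: leq_subr | rewrite mulNr; lia].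
    by rewrite mulNr; lia.
  have ltH := certificate_step q0 pT h IH1; split; first exact: ltW.
  by apply: mono => //; exact: leq_subr.
have down j : (j <= N)%N -> H N <= H j + (e + j%:Z * T) * q%:Z /\
                            K N <= K j + (e + j%:Z * T) * v%:Z.
  elim: j => [|j IH] jN.
    have ce' : - e <= c by have := ler_norm (- c); rewrite normrN; lia.
    have ceq (z : nat) : - (e * z%:Z) <= c * z%:Z.
      by rewrite -mulNr ler_wpM2r.
    by have := ceq q; have := ceq v; rewrite mul0r addr0; split; lia.
  have [IH1 IH2] := IH (ltnW jN).
  have eT : (j.+1%:Z * T) = j%:Z * T + T by rewrite -addn1 PoszD mulrDl mul1r.
  have := step _ jN; rewrite eT [e + (_ + _)]addrA.
  have flip (z z' y : int) : z <= z' + y -> - z' <= - z + y by lia.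
  case: ifP => _ /flip h.
    have ltK : - K j.+1 < - K N + (e + j%:Z * T + T) * v%:Z.
      by apply: certificate_step h _ => //; lia.
    split; last by lia.
    rewrite leNgt; apply/negP => ltH.
    have : K j.+1 <= K N + - (e + j%:Z * T + T) * v%:Z.
      by apply: mono => //; rewrite mulNr; lia.
    by rewrite mulNr; lia.
  have ltH : - H j.+1 < - H N + (e + j%:Z * T + T) * q%:Z.
    by apply: certificate_step h _ => //; lia.
  split; first by lia.
  by apply: mono => //; lia.
move=> k kN; have [h1 h2] := up (N - k)%N (leq_subr _ _).
have [h3 h4] := down k kN; rewrite subKn // in h1 h2.
have le1 : (N - k)%N%:Z * T <= N%:Z * T by rewrite (ler_wpM2r (ltW T0)) // lez_nat leq_subr.
have le2 : k%:Z * T <= N%:Z * T by rewrite (ler_wpM2r (ltW T0)) // lez_nat.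
have mulq (z : nat) (a b : int) : a <= b -> a * z%:Z <= b * z%:Z by exact: ler_wpM2r.
split.
- by apply: le_trans h1 _; rewrite lerD2l mulq.
- by apply: le_trans h3 _; rewrite lerD2l mulq // lerD2l.
- by apply: le_trans h2 _; rewrite lerD2l mulq.
- by apply: le_trans h4 _; rewrite lerD2l mulq // lerD2l.
Qed.

Definition nat_certificate l p q u v c (M : nat) (h k : nat -> nat) :=
  certificate l p q u v c (fun i => (h i)%:Z) (fun i => (k i)%:Z) /\
  forall i, (i <= size l)%N -> (h i <= M)%N /\ (k i <= M)%N.

Lemma exists_nat_certificate l p q u v c H K (a b e : nat) :
  (0 < q)%N -> (0 < v)%N -> (`|p| <= a)%N -> (`|u| <= b)%N -> (`|c| <= e)%N ->
  certificate l p q u v c H K ->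
  exists h k, nat_certificate l p q u v c
    ((e + size l * (a + b).+1) * (q + v)).*2 h k.
Proof.
move=> q0 v0 pa ub ce cert; set N := size l; set M := (_ * _)%N.
have abs (z : int) (n m : nat) : (`|z| <= n)%N -> (n < m)%N -> `|z| < m%:Z.
  by move=> zn nm; rewrite -abszE ltz_nat; exact: leq_ltn_trans nm.
(* T = a + b + 1 exceeds both |p| and |u|; the factor q + v in [M] dominates both denominators. *)
have bound := certificate_bound q0 v0 (abs p a (a + b).+1 pa _)
  (abs u b (a + b).+1 ub _) (_ : `|c| <= e%:Z) cert.
have {bound} bound i : (i <= N)%N ->
    [/\ H i <= H N + M%:Z, H N <= H i + M%:Z, K i <= K N + M%:Z & K N <= K i + M%:Z].
  move=> iN; have [||| h1 h2 h3 h4] := bound _ _ _ i iN.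
  - by rewrite ltnS leq_addr.
  - by rewrite ltnS leq_addl.
  - by rewrite -abszE lez_nat.
  have M1 (y : nat) : (y <= q + v)%N -> (N%:Z * (a + b).+1%:Z) * y%:Z <= M%:Z /\
      (e%:Z + N%:Z * (a + b).+1%:Z) * y%:Z <= M%:Z.
    move=> yqv; have -> : M%:Z = (e%:Z + N%:Z * (a + b).+1%:Z) * (q + v)%N%:Z.
      by rewrite /M !(PoszM, PoszD).
    have e0 : 0 <= e%:Z by [].
    have t0 : 0 <= N%:Z * (a + b).+1%:Z by rewrite -PoszM.
    have yz : y%:Z <= (q + v)%N%:Z by rewrite lez_nat.
    by split; apply: ler_pM; rewrite ?lerDr ?addr_ge0.
  have [q1 q2] := M1 q (leq_addr _ _); have [v1 v2] := M1 v (leq_addl _ _).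
  split.
  - by apply: le_trans h1 _; rewrite lerD2l.
  - by apply: le_trans h2 _; rewrite lerD2l.
  - by apply: le_trans h3 _; rewrite lerD2l.
  - by apply: le_trans h4 _; rewrite lerD2l.
(* Adding constants to [H] and [K] preserves certificates; this choice gives both the value [M] at
   the last index, so all values lie between 0 and 2M. *)
pose h i := absz (H i - H N + M%:Z); pose k i := absz (K i - K N + M%:Z).
have hE i : (i <= N)%N -> (h i)%:Z = H i - H N + M%:Z.
  by move=> /bound[_ ? _ _]; rewrite /h gez0_abs //; lia.
have kE i : (i <= N)%N -> (k i)%:Z = K i - K N + M%:Z.
  by move=> /bound[_ _ _ ?]; rewrite /k gez0_abs //; lia.
have [step mono Hend Kend] := cert; rewrite -/N in step mono Hend Kend.
exists h, k; split; last first.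
  move=> i iN; have [h1 h2 h3 h4] := bound i iN.
  rewrite -!lez_nat -addnn PoszD hE // kE //.
  by split; lia.
split; rewrite -/N.
- move=> i iN; have := step i iN; rewrite !hE ?kE //; try exact: ltnW.
  by case: ifP => _ ?; lia.
- move=> i j m iN jN; rewrite !hE // !kE // => lt.
  have := mono i j m iN jN; lia.
- by rewrite !hE //; lia.
- by rewrite !kE //; lia.
Qed.

End BoundedCertificates.


(** * The decision procedure on codes and its computability *)

Section Algorithm.
Local Open Scope nat_scope.
Implicit Types (w : F2) (wc pq cd up um h k m : nat).

Definition pos_part m := if odd m then 0 else m./2.
Definition neg_part m := if odd m then m./2.+1 else 0.

Lemma int_code_parts (z : int) :
  z = ((pos_part (int_code z))%:Z - (neg_part (int_code z))%:Z)%R.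
Proof.
case: z => n; rewrite /pos_part /neg_part /= odd_double ?uphalf_double ?doubleK /=.
  by rewrite subr0.
by rewrite NegzE sub0r.
Qed.

Lemma int_code_surj m : exists z, int_code z = m.
Proof.
exists (if odd m then Negz m./2 else Posz m./2).
by have := odd_double_half m; case: odd.
Qed.

Lemma int_code_abs (z : int) :
  `|z|%N <= pos_part (int_code z) + neg_part (int_code z).
Proof.
case: z => n; rewrite /pos_part /neg_part /= odd_double ?uphalf_double ?doubleK /=.
  by rewrite addn0.
by rewrite add0n.
Qed.

Definition orbit_length wc cd := code_nth cd 1 * code_size wc.
Definition common_denominator wc cd := (orbit_length wc cd)`!.

(** This is the bound of [code_bound] for [(orbit_length wc cd).+1] entries, each at most the bound
    of [exists_nat_certificate]. *)
Definition search_bound wc pq cd up um :=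
  2 ^ ((2 * ((pos_part (code_nth cd 0) + neg_part (code_nth cd 0) +
              orbit_length wc cd *
                (pos_part (code_nth pq 0) + neg_part (code_nth pq 0) + (up + um)).+1)
             * (code_nth pq 1 + common_denominator wc cd))).+1
       * (orbit_length wc cd).+1).

(* In the checks below the integers p, c and u are split into their positive and
   negative parts, and terms are moved across so that no truncated subtraction
   occurs. *)
Definition check_steps wc pq cd up um h k :=
  all (fun i =>
      ((code_nth wc (i %% code_size wc) == 1) ==>
        (code_nth k i + um <= code_nth k i.+1 + up)) &&
      ((code_nth wc (i %% code_size wc) != 1) ==>
        (code_nth h i + neg_part (code_nth pq 0) <=
         code_nth h i.+1 + pos_part (code_nth pq 0))))
    (iota 0 (orbit_length wc cd)).

Definition check_order wc pq cd up um h k :=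
  all (fun i => all (fun j => all (fun m =>
      (((code_nth h i).+1 <= code_nth h j + m * code_nth pq 1) ==>
        (code_nth k i <= code_nth k j + m * common_denominator wc cd)) &&
      (((code_nth h i + m * code_nth pq 1).+1 <= code_nth h j) ==>
        (code_nth k i + m * common_denominator wc cd <= code_nth k j)))
    (iota 0 (search_bound wc pq cd up um)))
    (iota 0 (orbit_length wc cd).+1)) (iota 0 (orbit_length wc cd).+1).

Definition check_end wc pq cd h k :=
  (code_nth h (orbit_length wc cd) + pos_part (code_nth cd 0) * code_nth pq 1 <=
   code_nth h 0 + neg_part (code_nth cd 0) * code_nth pq 1) &&
  (code_nth k (orbit_length wc cd) +
     pos_part (code_nth cd 0) * common_denominator wc cd <=
   code_nth k 0 + neg_part (code_nth cd 0) * common_denominator wc cd).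

Definition check_certifiable wc pq cd up um :=
  has (fun h => has (fun k =>
      [&& check_steps wc pq cd up um h k, check_order wc pq cd up um h k &
          check_end wc pq cd h k])
    (iota 0 (search_bound wc pq cd up um))) (iota 0 (search_bound wc pq cd up um)).

(** Certifiability is monotone in u, so success at u and failure at u - 1 identify the least u
    without an unbounded search below it. *)
Definition check_least wc pq cd m :=
  check_certifiable wc pq cd (pos_part m) (neg_part m) &&
  ~~ check_certifiable wc pq cd (pos_part m) (neg_part m).+1.

Lemma computable_pos_part n f : computable n f -> computable n (fun xs => pos_part (f xs)).
Proof.
move=> cf; apply: computable_if; first exact: decidable_odd.
  exact: computable_const.
exact: computable_half.
Qed.

Lemma computable_neg_part n f : computable n f -> computable n (fun xs => neg_part (f xs)).
Proof.
move=> cf; apply: computable_if; first exact: decidable_odd.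
  by apply: computable_succ; exact: computable_half.
exact: computable_const.
Qed.

Ltac computability := repeat lazymatch goal with
  | |- computable ?n (fun xs => nth 0 xs ?i) => exact (computable_nth n 0 i)
  | |- computable ?n (fun xs => nth 0 (behead xs) ?i) => exact (computable_nth n 1 i)
  | |- computable ?n (fun xs => nth 0 (behead (behead xs)) ?i) =>
      exact (computable_nth n 2 i)
  | |- computable ?n (fun xs => nth 0 (behead (behead (behead xs))) ?i) =>
      exact (computable_nth n 3 i)
  | |- computable ?n (fun xs => nth 0 (behead (behead (behead (behead xs)))) ?i) =>
      exact (computable_nth n 4 i)
  | |- computable ?n (fun xs => nth 0 (behead (behead (behead (behead (behead xs))))) ?i) =>
      exact (computable_nth n 5 i)
  | |- computable _ (fun xs => (@?f xs).+1) => refine (@computable_succ _ f _)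
  | |- computable _ (fun xs => @?f xs + @?g xs) => refine (@computable_add _ f g _ _)
  | |- computable _ (fun xs => @?f xs * @?g xs) => refine (@computable_mul _ f g _ _)
  | |- computable _ (fun xs => @?f xs ^ @?g xs) => refine (@computable_exp _ f g _ _)
  | |- computable _ (fun xs => @?f xs %% @?g xs) => refine (@computable_mod _ f g _ _)
  | |- computable _ (fun xs => (@?f xs)`!) => refine (@computable_fact _ f _)
  | |- computable _ (fun xs => pos_part (@?f xs)) => refine (@computable_pos_part _ f _)
  | |- computable _ (fun xs => neg_part (@?f xs)) => refine (@computable_neg_part _ f _)
  | |- computable _ (fun xs => code_nth (@?f xs) (@?g xs)) =>
      refine (@computable_code_nth _ f g _ _)
  | |- computable _ (fun xs => code_size (@?f xs)) =>
      refine (@computable_code_size _ f _)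
  | |- decidable_pred _ (fun xs => @?f xs <= @?g xs) => refine (@decidable_leq _ f g _ _)
  | |- decidable_pred _ (fun xs => @?f xs == @?g xs) => refine (@decidable_eq _ f g _ _)
  | |- decidable_pred _ (fun xs => @?f xs && @?g xs) => refine (@decidable_and _ f g _ _)
  | |- decidable_pred _ (fun xs => @?f xs ==> @?g xs) =>
      refine (@decidable_imply _ f g _ _)
  | |- decidable_pred _ (fun xs => ~~ @?f xs) => refine (@decidable_neg _ f _)
  | |- decidable_pred _ (fun xs => all (@?P xs) (iota 0 (@?n xs))) =>
      refine (@decidable_all _ n (fun i xs => P xs i) _ _)
  | |- decidable_pred _ (fun xs => has (@?P xs) (iota 0 (@?n xs))) =>
      refine (@decidable_has _ n (fun i xs => P xs i) _ _)
  | |- computable _ (fun _ => ?n) => exact (computable_const _ n)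
  end; cbv beta.

Lemma computable_denominator n f g : computable n f -> computable n g ->
  computable n (fun xs => common_denominator (f xs) (g xs)).
Proof.
apply: (computable2 (F := common_denominator)).
by rewrite /common_denominator /orbit_length; computability.
Qed.

Lemma decidable_check_least : decidable_pred 4 (fun xs =>
  check_least (nth 0 xs 1) (nth 0 xs 2) (nth 0 xs 3) (nth 0 xs 0)).
Proof.
rewrite /check_least /check_certifiable /check_steps /check_order /check_end.
rewrite /search_bound /common_denominator /orbit_length.
computability.
Qed.

Lemma computes_search n (P : seq nat -> bool) : decidable_pred n.+1 P -> exists e, forall xs i,
  size xs = n -> P (i :: xs) -> (forall j, j < i -> ~~ P (j :: xs)) ->
  computes (MMin e) xs i.
Proof.
move=> /decidable_neg[e he]; exists e => xs i xn Pi mini.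
(* [MMin] stops at the first zero, so it runs on the negated test, whose value is 1, the successor
   of 0, before the solution. *)
apply: (@computes_min e xs i (fun=> 0)).
  by move=> j /mini Pj; have := he (j :: xs); rewrite /= xn Pj => /(_ erefl).
by have := he (i :: xs); rewrite /= xn Pi => /(_ erefl).
Qed.

Lemma computable_pair : computable 2
  (fun ys => CodeSeq.code [:: nth 0 ys 0; nth 0 ys 1]).
Proof.
apply: (@computable_ext _ (fun ys => 2 ^ nth 0 ys 0 * (2 * 2 ^ nth 0 ys 1).+1)).
  by move=> ys _ /=; rewrite muln1 mul2n.
computability.
Qed.

End Algorithm.

(** * Agreement of the checks on codes with certificates *)

Section Correctness.
Variables (w : F2) (p c : int) (q d : nat).
Hypotheses (pw : positive w) (q0 : (0 < q)%N).
Let wc := word_code w.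
Let pq := frac_code p q.
Let cd := frac_code c d.
Let N := orbit_length wc cd.
Let D := common_denominator wc cd.
Let L := flatten (nseq d (letters w)).

Lemma size_word_code : code_size wc = size (letters w).
Proof. by rewrite /wc /word_code code_sizeE !size_map. Qed.

Lemma nth_flatten_nseq (T : Type) (x0 : T) (s : seq T) n i : (i < n * size s)%N ->
  nth x0 (flatten (nseq n s)) i = nth x0 s (i %% size s).
Proof.
elim: n i => [|n IH] i; first by rewrite mul0n.
rewrite mulSn /= nth_cat => lt; case: ltnP => si; first by rewrite modn_small.
rewrite IH; last by rewrite ltn_subLR.
by rewrite -{2}(subnK si) modnDr.
Qed.

Lemma orbit_lengthE : N = size L.
Proof.
by rewrite /N /orbit_length /cd /frac_code code_nthE size_word_code flatten_nseq_size.
Qed.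

(** Positivity leaves only the letter codes 0 for a and 1 for b. *)
Lemma nth_word_code i : (i < N)%N ->
  (code_nth wc (i %% code_size wc) == 1)%N = nth false L i.
Proof.
rewrite orbit_lengthE flatten_nseq_size size_word_code => lt.
rewrite nth_flatten_nseq //; set j := (_ %% _)%N.
have n0 : (0 < size (letters w))%N by case: (size _) lt; rewrite ?muln0.
have jn : (j < size (val w))%N by rewrite -(size_map fst) ltn_mod.
rewrite /wc /word_code code_nthE (nth_map (false, false)) //.
rewrite /letters (nth_map (false, false)) //.
have := allP pw _ (mem_nth (false, false) jn).
by case: (nth _ _ _) => -[] [].
Qed.

Lemma common_denominator_gt0 : (0 < D)%N.
Proof. exact: fact_gt0. Qed.

Lemma check_certificate up um h k :
  (h < search_bound wc pq cd up um)%N -> (k < search_bound wc pq cd up um)%N ->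
  [&& check_steps wc pq cd up um h k, check_order wc pq cd up um h k &
      check_end wc pq cd h k] <->
  certificate L p q (up%:Z - um%:Z) D c
    (fun i => (code_nth h i)%:Z) (fun i => (code_nth k i)%:Z).
Proof.
move=> hb kb; have D0 := common_denominator_gt0.
have pE : p = (pos_part (code_nth pq 0))%:Z - (neg_part (code_nth pq 0))%:Z.
  by rewrite /pq /frac_code code_nthE; exact: int_code_parts.
have cE : c = (pos_part (code_nth cd 0))%:Z - (neg_part (code_nth cd 0))%:Z.
  by rewrite /cd /frac_code code_nthE; exact: int_code_parts.
have qE : code_nth pq 1 = q by rewrite /pq /frac_code code_nthE.
rewrite /check_steps /check_order /check_end -/N -/D qE.
split.
- move=> /and3P[/allP steps /allP order /andP[end1 end2]]; split.
  + move=> i; rewrite -orbit_lengthE => iN.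
    have := steps i; rewrite mem_iota iN nth_word_code // => /(_ isT).
    by case: (nth _ _ _) => /=; rewrite ?andbT => ?; lia.
  + move=> i j m; rewrite -orbit_lengthE => iN jN lt.
    have := order i; rewrite mem_iota ltnS iN => /(_ isT) /allP /(_ j).
    rewrite mem_iota ltnS jN => /(_ isT) /allP order'.
    have hj := code_nth_le h j; have ki := code_nth_le k i.
    have hj' : (code_nth h j <= search_bound wc pq cd up um)%N by exact: leq_trans hj (ltnW hb).
    have ki' : (code_nth k i <= search_bound wc pq cd up um)%N by exact: leq_trans ki (ltnW kb).
    have [mb|mb] := ltnP `|m|%N (search_bound wc pq cd up um).
      have := order' `|m|%N; rewrite mem_iota mb => /(_ isT) /andP[/implyP o1 /implyP o2].
      case: m lt {mb} o1 o2 => m lt /= o1 o2.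
        have : (code_nth k i <= code_nth k j + m * D)%N by apply: o1; lia.
        by rewrite -PoszM; lia.
      have o3 : (code_nth k i + m.+1 * D <= code_nth k j)%N.
        by apply: o2; move: lt; rewrite NegzE mulNr -PoszM; lia.
      by move: o3; rewrite NegzE mulNr -PoszM; lia.
    (* Beyond the range of the check the order condition is automatic: all entries are below the
       search bound, so the conclusion holds for large positive m and the premise fails for large
       negative m. *)
    case: m lt mb => m lt mb; rewrite ?NegzE /= in lt mb *.
      have : (m <= m * D)%N by rewrite leq_pmulr.
      by rewrite -PoszM; lia.
    have : (m.+1 <= m.+1 * q)%N by rewrite leq_pmulr.
    by move: lt; rewrite mulNr -PoszM; lia.
  + by rewrite -orbit_lengthE cE; nia.
  + by rewrite -orbit_lengthE cE; nia.
- rewrite -/L => -[step mono Hend Kend]; rewrite -orbit_lengthE in step mono Hend Kend.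
  apply/and3P; split.
  + apply/allP => i; rewrite mem_iota => /andP[_ iN].
    rewrite nth_word_code //; have := step i iN.
    by case: (nth _ _ _) => /=; rewrite ?andbT => ?; lia.
  + apply/allP => i; rewrite mem_iota ltnS => /andP[_ iN].
    apply/allP => j; rewrite mem_iota ltnS => /andP[_ jN].
    apply/allP => m _; apply/andP; split; apply/implyP => lt.
      by have := mono i j m iN jN; rewrite -!PoszM; lia.
    by have := mono i j (- m%:Z) iN jN; rewrite !mulNr -!PoszM; lia.
  + by apply/andP; split; move: Hend Kend; rewrite cE; nia.
Qed.

Lemma check_certifiableP up um : check_certifiable wc pq cd up um <->
  certifiable (letters w) p q c d D (up%:Z - um%:Z).
Proof.
have D0 := common_denominator_gt0; split.
  move=> /hasP[h]; rewrite mem_iota => /andP[_ hb] /hasP[k].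
  rewrite mem_iota => /andP[_ kb] /(check_certificate hb kb) cert.
  by exists (fun i => (code_nth h i)%:Z), (fun i => (code_nth k i)%:Z).
move=> [H [K cert]].
have pa : (`|p| <= pos_part (code_nth pq 0) + neg_part (code_nth pq 0))%N.
  by rewrite /pq /frac_code code_nthE; exact: int_code_abs.
have ca : (`|c| <= pos_part (code_nth cd 0) + neg_part (code_nth cd 0))%N.
  by rewrite /cd /frac_code code_nthE; exact: int_code_abs.
have ua : (`|(up%:Z - um%:Z)%R| <= up + um)%N by lia.
have [h [k [cert' bnd]]] := exists_nat_certificate q0 D0 pa ua ca cert.
rewrite -orbit_lengthE in bnd.
set M := (_.*2)%N in bnd.
pose code (f : nat -> nat) := CodeSeq.code (mkseq f N.+1).
have codeE f i : (i <= N)%N -> code_nth (code f) i = f i.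
  by move=> iN; rewrite code_nthE nth_mkseq.
have codeb f : (forall i, (i <= N)%N -> (f i <= M)%N) ->
    (code f < search_bound wc pq cd up um)%N.
  move=> fM; have := @code_bound M (mkseq f N.+1); rewrite size_mkseq => lt.
  rewrite /search_bound -/N -/D mul2n.
  have -> : code_nth pq 1 = q by rewrite /pq /frac_code code_nthE.
  apply: lt; apply/(all_nthP 0%N) => i; rewrite size_mkseq ltnS => iN.
  by rewrite nth_mkseq // fM.
have hb := codeb h (fun i iN => (bnd i iN).1).
have kb := codeb k (fun i iN => (bnd i iN).2).
apply/hasP; exists (code h); first by rewrite mem_iota.
apply/hasP; exists (code k); first by rewrite mem_iota.
apply/(check_certificate hb kb).
have [step mono Hend Kend] := cert'.
rewrite /certificate -orbit_lengthE in step mono Hend Kend *; split.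
- by move=> i iN; have := step i iN; rewrite !codeE // ltnW.
- by move=> i j m iN jN; have := mono i j m iN jN; rewrite !codeE.
- by rewrite !codeE.
- by rewrite !codeE.
Qed.

Lemma check_leastP (u : int) : check_least wc pq cd (int_code u) <->
  certifiable (letters w) p q c d D u /\ ~ certifiable (letters w) p q c d D (u - 1).
Proof.
have uE := int_code_parts u.
have u1E : u - 1 = (pos_part (int_code u))%:Z - (neg_part (int_code u)).+1%:Z.
  by rewrite {1}uE -[(neg_part _).+1]addn1 PoszD; ring.
split.
  move=> /andP[/check_certifiableP h1 /negP h2]; rewrite u1E {1}uE.
  by split=> // /check_certifiableP.
rewrite u1E {1}uE => -[/check_certifiableP h1 h2]; apply/andP; split=> //.
by apply/negP => /check_certifiableP.
Qed.

End Correctness.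

Theorem mainTheorem4 (R : realType) :
  exists alg : murec,
  forall (w : F2) (p : int) (q : nat) (c : int) (d : nat),
    positive w -> occurs true w ->
    (0 < q)%N -> (0 < d)%N -> coprime `|c|%N d ->
    let S := [set t : R | maxrot w (p%:~R / q%:R) t = c%:~R / d%:R] in
    S !=set0 ->
    (occurs false w -> (d <= q)%N) /\
    exists (u : int) (v : nat),
      [/\ (0 < v)%N,
          has_inf S,
          inf S = u%:~R / v%:R,
          maxrot w (p%:~R / q%:R) (u%:~R / v%:R) = c%:~R / d%:R :> R
        & computes alg
            [:: word_code w; frac_code p q; frac_code c d] (frac_code u v)].
Proof.
have [es hes] := computes_search decidable_check_least.
have [eD heD] : computable 3 (fun xs => common_denominator (nth 0%N xs 0) (nth 0%N xs 2)).
  by apply: computable_denominator; exact: computable_var.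
have [eo heo] := computable_pair.
(* The program finds the code of u by search, computes D and pairs the two; the fraction u/D is
   output without reduction. *)
exists (MComp eo [:: MMin es; eD]) => w p q c d pw bw q0 d0 cd S S0.
pose D := common_denominator (word_code w) (frac_code c d).
have D0 : (0 < D)%N by exact: fact_gt0.
have hD v : (0 < v <= d * size (letters w))%N -> (v %| D)%N.
  rewrite /D /common_denominator orbit_lengthE flatten_nseq_size.
  exact: dvdn_fact.
split; first by have [t St] := S0; have [] := maxrot_attained pw bw q0 d0 cd St.
have [[u0 [Cu0 nCu0]] level] := maxrot_level pw bw q0 d0 cd D0 hD S0.
pose P m := check_least (word_code w) (frac_code p q) (frac_code c d) m.
have exP : exists m, P m by exists (int_code u0); apply/check_leastP.
(* Minimality is for the coding order, as required by [MMin]; [level] applies to any u that passes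
   the test, so the order in which integers are tried does not matter. *)
case: (ex_minnP exP) => m Pm minm.
have [u um] := int_code_surj m; rewrite -um in Pm minm.
have [Cu nCu] := (check_leastP _ _ _ pw q0 u).1 Pm.
have [hS infS maxu] := level u Cu nCu.
exists u, D; split=> //.
apply: (@computes_comp _ _ _ [:: int_code u; D]); last exact: heo.
apply: computes_cons.
  apply: hes => // n nu /=; apply/negP => /minm.
  by rewrite leqNgt nu.
apply: computes_cons; last exact: computes_nil.
exact: heD.
Qed.
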